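(* Let $\mathcal{E}=(E,\ast)$ be a finite biordered set and let $D_1,\dots,D_m$ ($m\geqslant 1$) be regular $\mathscr{D}$-classes of $\mathsf{IG}(\mathcal{E})$, where $D_k$ is coordinatised by triples in $I_k\times G_k\times\Lambda_k$, with $I_k$ (resp. $\Lambda_k$) an index set for the $\mathscr{R}$-classes (resp. $\mathscr{L}$-classes) of $D_k$. There exist rational subsets $\rho_s(\lambda,i;\mu,j)$ of $G_s\times G_{s+1}^\partial$, for $1\leqslant s<m$, $\lambda,\mu\in\Lambda_s$, $i,j\in I_{s+1}$, that are effectively computable from the biordered set $\mathcal{E}$, such that the following holds. Whenever $(i_k,g_k,\lambda_k),(j_k,h_k,\mu_k)\in D_k$ ($1\leqslant k\leqslant m$) are such that both $(i_1,g_1,\lambda_1),\dots,(i_m,g_m,\lambda_m)$ and $(j_1,h_1,\mu_1),\dots,(j_m,h_m,\mu_m)$ form irreducible r-sequences, the equality $$(i_1,g_1,\lambda_1)\dots (i_m,g_m,\lambda_m) = (j_1,h_1,\mu_1)\dots (j_m,h_m,\mu_m)$$ holds in $\mathsf{IG}(\mathcal{E})$ if and only if $i_1=j_1$, $\lambda_m=\mu_m$, and the problem $$\mathbf{P}(G_1,\dots,G_m;\rho_1(\lambda_1,i_2;\mu_1,j_2),\dots,\rho_{m-1}(\lambda_{m-1},i_m;\mu_{m-1},j_m))$$ returns a positive answer on input $a_k=g_k$, $b_k=h_k$, $1\leqslant k\leqslant m$.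
   Context: For a semigroup $S$ with set of idempotents $E=E(S)$, the biordered set of $S$ is the partial algebra $\mathcal{E}_S=(E,\ast)$ in which $e\ast f$ is defined, and equal to $ef$, exactly when $\{e,f\}$ is a basic pair, i.e. $\{e,f\}\cap\{ef,fe\}\neq\varnothing$. A biordered set is a partial algebra isomorphic to some $\mathcal{E}_S$; it is finite if $E$ is finite. $\mathsf{IG}(\mathcal{E})$ is the semigroup presented by generators $\overline{E}=\{\overline{e}: e\in E\}$ and relations $\overline{e}\,\overline{f}=\overline{e\ast f}$ for all basic pairs $\{e,f\}$. It is known that its idempotents are exactly the $\overline{e}$, $e\in E$, and that $e\mapsto\overline e$ is an isomorphism of biordered sets. Green's relations are taken in $\mathsf{IG}(\mathcal{E})$. A $\mathscr{D}$-class is regular if it contains an idempotent. Irreducible r-sequences. A sequence $(\mathbf{r}_1,\dots,\mathbf{r}_m)$ of regular elements of $\mathsf{IG}(\mathcal{E})$ is an irreducible r-sequence if no product $\mathbf{r}_i\mathbf{r}_{i+1}\dots\mathbf{r}_j$ with $i<j$ is regular in $\mathsf{IG}(\mathcal{E})$. Coordinatisation. For a regular $\mathscr{D}$-class $D$, $D$ is a $\mathscr{J}$-class and its principal factor $D^0=D\cup\{0\}$ is completely $0$-simple. Let $I,\Lambda$ index the $\mathscr{R}$-classes $R_i$ and $\mathscr{L}$-classes $L_\lambda$ of $D$ (finite sets, which can be read off $\mathcal{E}$). Fix an isomorphism from $D^0$ to a Rees matrix semigroup $\mathcal{M}^0[G;I,\Lambda;P]$ (product $(i,g,\lambda)(j,h,\mu)=(i,gp_{\lambda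 j}h,\mu)$ if $p_{\lambda j}\ne 0$, and $0$ otherwise), under which $(i,g,\lambda)$ is identified with an element of $R_i\cap L_\lambda\subseteq D$. Here $G$ is isomorphic to the maximal subgroups of $D$, and $p_{\lambda i}\ne0$ iff $R_i\cap L_\lambda$ contains an idempotent; exactly then put $f_{i\lambda}=p_{\lambda i}^{-1}$. It is known that this can be done so that $G$ is given by a finite presentation, algorithmically computable from $\mathcal{E}$, whose generators are the $f_{i\lambda}$, and such a coordinatisation (with group denoted $G_k$ for $D_k$) is fixed for every regular $\mathscr{D}$-class. Products of triples in the claim are products in $\mathsf{IG}(\mathcal{E})$ of the elements they represent. Rational subsets. For a group $H$, $H^\partial$ is the dual (opposite) group, so $G_s\times G_{s+1}^\partial$ has operation $(g_1,g_2)\star(h_1,h_2)=(g_1h_1,h_2g_2)$. The family of rational subsets of a monoid $M$ is the smallest family of subsets containing all finite subsets and closed under binary union, product $AB$ and generated submonoid $A^\ast$. ''Effectively computable from $\mathcal{E}$'' means that there is an algorithm which, from $\mathcal{E}$ (and the $\mathscr{D}$-classes and indices in question), returns a rational expression (or finite automaton) over the generators $f_{i\lambda}$ of the two groups and their inverses specifying the subset. The problem $\mathbf{P}(G_1,\dots,G_m;\rho_1,\dots,\rho_{m-1})$, for finitely presented groups $G_k$ and rational subsets $\rho_s\subseteq G_s\times G_{s+1}^\partial$, is: on input $a_k,b_k\in G_k$ ($1\leqslant k\leqslant m$), decide whether there exist $x_t\in G_t$, $2\leqslant t\leqslant m-1$, such that $(a_1^{-1}b_1, x_2)\in\rho_1$;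 $(a_r^{-1}x_r^{-1}b_r,x_{r+1})\in\rho_r$ for $2\leqslant r\leqslant m-2$; and $(a_{m-1}^{-1}x_{m-1}^{-1}b_{m-1},b_ma_m^{-1})\in\rho_{m-1}$. For $m=2$ this means the single condition $(a_1^{-1}b_1,b_2a_2^{-1})\in\rho_1$, and for $m=1$ it means the condition $a_1=b_1$. *)

(* Defs.v *)
From HB Require Import structures.
From mathcomp Require Import all_boot generic_quotient.
From mathcomp Require Import boolp classical_sets functions cardinality.

Set Implicit Arguments.
Unset Strict Implicit.
Unset Printing Implicit Defensive.

Local Open Scope classical_set_scope.
Local Open Scope group_scope.

Section Semigroups.
Variable S : semigroupType.
Implicit Types (x y z e f : S) (D : set S).

Definition idem e := e * e = e.

Definition basic_pair e f :=
  [\/ e * f = e, e * f = f, f * e = e | f * e = f].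

Definition regular_elt x := exists y, x * y * x = x.

(* Inclusion of principal one-sided ideals: xS^1 in yS^1, resp. S^1x in S^1y. *)
Definition leR x y := x = y \/ exists z, x = y * z.
Definition leL x y := x = y \/ exists z, x = z * y.

Definition greenR x y := leR x y /\ leR y x.
Definition greenL x y := leL x y /\ leL y x.
Definition greenD x y := exists z, greenL x z /\ greenR z y.

Definition is_Dclass D := exists x, D = [set y | greenD x y].

Record regDclass := RegDclass {
  dcls :> set S;
  dcls_class : is_Dclass dcls;
  dcls_regular : exists2 e, dcls e & idem e }.

(* [r_i * r_(i+1) * ... * r_j], for [i <= j] *)
Definition ordprod m (r : 'I_m -> S) (i j : 'I_m) : S :=
  foldl *%g (r i) [seq r k | k : 'I_m <- enum 'I_m & i < k <= j].

Definition irreducible_rseq m (r : 'I_m -> S) :=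
  (forall k, regular_elt (r k)) /\
  (forall i j : 'I_m, i < j -> ~ regular_elt (ordprod r i j)).

End Semigroups.

(* The partial product [bop] is a table: [None] means undefined. *)
Record biordered (E : finType) := Biordered {
  bop : E -> E -> option E;
  bopP : exists (S : semigroupType) (phi : E -> S),
    [/\ injective phi,
        forall s, idem s <-> exists e, s = phi e &
        forall e f g, bop e f = Some g <->
          basic_pair (phi e) (phi f) /\ phi e * phi f = phi g] }.

Section IG.
Variables (E : finType) (B : biordered E).

Inductive ig_eq : seq E -> seq E -> Prop :=
| ig_refl u : ig_eq u u
| ig_sym u v : ig_eq u v -> ig_eq v u
| ig_trans u v w : ig_eq u v -> ig_eq v w -> ig_eq u w
| ig_rel u v e f g : bop B e f = Some g ->
    ig_eq (u ++ [:: e; f] ++ v) (u ++ [:: g] ++ v).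

Lemma ig_cat u u' v v' : ig_eq u u' -> ig_eq v v' -> ig_eq (u ++ v) (u' ++ v').
Proof.
move=> huu hvv; apply: (@ig_trans _ (u' ++ v)).
  elim: huu v {hvv} => [w v|w1 w2 _ IH v|w1 w2 w3 _ IH1 _ IH2 v|w1 w2 e f g h v].
  - exact: ig_refl.
  - exact: ig_sym.
  - exact: ig_trans (IH1 v) (IH2 v).
  - by rewrite -!catA; apply: (ig_rel w1 (w2 ++ v) h).
elim: hvv => [w|w1 w2 _ IH|w1 w2 w3 _ IH1 _ IH2|w1 w2 e f g h].
- exact: ig_refl.
- exact: ig_sym.
- exact: ig_trans IH1 IH2.
- by rewrite !(catA u'); apply: ig_rel.
Qed.

(* Nonempty words, as pairs (first letter, remaining letters). *)
Definition igword := (E * seq E)%type.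
Definition igseq (w : igword) : seq E := w.1 :: w.2.

Definition igR : rel igword := fun v w => `[< ig_eq (igseq v) (igseq w) >].

Lemma igR_refl : reflexive igR.
Proof. by move=> u; apply/asboolP; apply: ig_refl. Qed.
Lemma igR_sym : symmetric igR.
Proof. by move=> u v; apply/asboolP/asboolP; apply: ig_sym. Qed.
Lemma igR_trans : transitive igR.
Proof.
move=> v u w /asboolP h1 /asboolP h2; apply/asboolP; exact: ig_trans h1 h2.
Qed.

Canonical igR_rel := EquivRel igR igR_refl igR_sym igR_trans.

Local Open Scope quotient_scope.

Definition IG := {eq_quot igR}.
HB.instance Definition _ := EqQuotient.on IG.
HB.instance Definition _ := Choice.on IG.

Definition ig_mul (x y : IG) : IG :=
  \pi_IG ((repr x).1, (repr x).2 ++ igseq (repr y)).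

Lemma ig_mulA : associative ig_mul.
Proof.
have pie (v w : igword) : \pi_IG v = \pi_IG w <-> ig_eq (igseq v) (igseq w).
  split=> [/eqmodP/asboolP //|h]; apply/eqmodP/asboolP; exact: h.
have reprE (w : igword) : ig_eq (igseq (repr (\pi_IG w))) (igseq w).
  by apply/pie; rewrite reprK.
move=> x y z; apply/pie; rewrite /ig_mul.
set a := repr x; set b := repr y; set c := repr z.
apply: (@ig_trans _ (igseq a ++ igseq b ++ igseq c)).
  exact: (ig_cat (ig_refl (igseq a)) (reprE _)).
rewrite catA; apply/ig_sym.
exact: (ig_cat (reprE (a.1, a.2 ++ igseq b)) (ig_refl _)).
Qed.

HB.instance Definition _ := isSemigroup.Build IG ig_mulA.

Definition ig_gen (e : E) : IG := \pi_IG (e, [::]).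

End IG.

(* [crd] is the isomorphism from the Rees matrix semigroup onto the principal
   factor of [D], restricted to nonzero elements; [None] is the zero of the
   group with zero in which the sandwich matrix has its entries. *)
Definition rees_mul (G : groupType) (I L : Type) (P : L -> I -> option G)
    (x y : I * G * L) : option (I * G * L) :=
  let: (i, g, l) := x in let: (j, h, mu) := y in
  omap (fun p => (i, g * p * h, mu)) (P l j).

Record coordinatisation (S : semigroupType) (D : set S) := Coordinatisation {
  crd_grp : groupType;
  crd_I : finType;
  crd_L : finType;
  crd_mx : crd_L -> crd_I -> option crd_grp;
  crd : crd_I * crd_grp * crd_L -> S;
  crd_bij : set_bij setT D crd;
  crd_mul : forall x y, match rees_mul crd_mx x y with
                        | Some z => crd x * crd y = crd z
                        | None => ~ D (crd x * crd y)
                        end;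
  crd_greenR : forall x y, greenR (crd x) (crd y) <-> x.1.1 = y.1.1;
  crd_greenL : forall x y, greenL (crd x) (crd y) <-> x.2 = y.2 }.

Section Coordinates.
Variables (S : semigroupType) (D : set S) (C : coordinatisation D).

Definition Rcls (i : crd_I C) : set S := [set s | exists g l, s = crd (i, g, l)].
Definition Lcls (l : crd_L C) : set S := [set s | exists i g, s = crd (i, g, l)].

Definition fgen (i : crd_I C) (l : crd_L C) : option (crd_grp C) :=
  omap (fun p => p^-1) (crd_mx l i).

End Coordinates.

(* The generator [fgen i l] exists iff the H-class of row [i] and column [l]
   contains an idempotent, which is then the image of a unique [e : E]; that
   [e] is used as its formal name.  [(e, true)] names the inverse. *)
Definition letter (E : Type) := (E * bool)%type.

Section Letters.
Variables (E : finType) (B : biordered E) (D : set (IG B)).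
Variable C : coordinatisation D.

Definition letter_val (a : letter E) (g : crd_grp C) :=
  exists i l f, [/\ Rcls i (ig_gen B a.1), Lcls l (ig_gen B a.1),
                    fgen i l = Some f & g = if a.2 then f^-1 else f].

Fixpoint word_val (w : seq (letter E)) (g : crd_grp C) : Prop :=
  match w with
  | [::] => g = 1
  | a :: w' => exists x y, [/\ letter_val a x, word_val w' y & g = x * y]
  end.

Definition relator E := (seq (letter E) * seq (letter E))%type.

Inductive pres_eq (rels : seq (relator E)) :
  seq (letter E) -> seq (letter E) -> Prop :=
| pres_refl u : pres_eq rels u u
| pres_sym u v : pres_eq rels u v -> pres_eq rels v u
| pres_trans u v w : pres_eq rels u v -> pres_eq rels v w -> pres_eq rels u w
| pres_free u v e b : (exists g, letter_val (e, b) g) ->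
    pres_eq rels (u ++ [:: (e, b); (e, ~~ b)] ++ v) (u ++ v)
| pres_rel u v r : r \in rels -> pres_eq rels (u ++ r.1 ++ v) (u ++ r.2 ++ v).

Definition presents (rels : seq (relator E)) :=
  [/\ forall r, r \in rels ->
        (exists g, word_val r.1 g) /\ (exists g, word_val r.2 g),
      forall g, exists w, word_val w g &
      forall u v g h, word_val u g -> word_val v h ->
        (g = h <-> pres_eq rels u v)].

End Letters.

Definition dual_group (G : Type) : Type := G.

Section Dual.
Variable G : groupType.

Definition dual_mul (x y : dual_group G) : dual_group G := (y : G) * (x : G).
Definition dual_one : dual_group G := 1 : G.
Definition dual_inv (x : dual_group G) : dual_group G := (x : G)^-1.

Lemma dual_mulA : associative dual_mul.
Proof. by move=> x y z; rewrite /dual_mul mulgA. Qed.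
Lemma dual_mul1 : left_id dual_one dual_mul.
Proof. exact: mulg1. Qed.
Lemma dual_mul1r : right_id dual_one dual_mul.
Proof. exact: mul1g. Qed.
Lemma dual_mulV : left_inverse dual_one dual_inv dual_mul.
Proof. exact: mulgV. Qed.
Lemma dual_mulVr : right_inverse dual_one dual_inv dual_mul.
Proof. exact: mulVg. Qed.

HB.instance Definition _ := Choice.copy (dual_group G) G.
HB.instance Definition _ := isGroup.Build (dual_group G)
  dual_mulA dual_mul1 dual_mul1r dual_mulV dual_mulVr.

End Dual.

Section Rational.
Variable M : monoidType.

Definition mulset (A B : set M) : set M :=
  [set x | exists a b, [/\ A a, B b & x = a * b]].

Inductive submonoid_gen (A : set M) : set M :=
| submonoid_1 : submonoid_gen A 1
| submonoid_M a x : A a -> submonoid_gen A x -> submonoid_gen A (a * x).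

Inductive rational : set M -> Prop :=
| rational_fin A : finite_set A -> rational A
| rational_U A B : rational A -> rational B -> rational (A `|` B)
| rational_M A B : rational A -> rational B -> rational (mulset A B)
| rational_star A : rational A -> rational (submonoid_gen A).

End Rational.

Inductive ratexp (A : Type) :=
| RVoid | REps | RSym of A
| RUnion of ratexp A & ratexp A
| RProd of ratexp A & ratexp A
| RStar of ratexp A.
Arguments RVoid {A}.
Arguments REps {A}.

(* [denotes val r X]: [r] is an expression over the letters that name elements
   of [M] (through [val]), and it specifies the subset [X]. *)
Inductive denotes (A : Type) (M : monoidType) (val : A -> M -> Prop) :
  ratexp A -> set M -> Prop :=
| denotes_void : denotes val RVoid set0
| denotes_eps : denotes val REps [set 1]
| denotes_sym a x : val a x -> denotes val (RSym a) [set x]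
| denotes_union r s X Y : denotes val r X -> denotes val s Y ->
    denotes val (RUnion r s) (X `|` Y)
| denotes_prod r s X Y : denotes val r X -> denotes val s Y ->
    denotes val (RProd r s) (mulset X Y)
| denotes_star r X : denotes val r X -> denotes val (RStar r) (submonoid_gen X).

(* [inl a] names [(g, 1)] and [inr a] names [(1, g)], where [a] names [g]. *)
Definition letter2 (E : Type) := (letter E + letter E)%type.

Definition letter2_val (E : finType) (B : biordered E) (D1 D2 : set (IG B))
    (C1 : coordinatisation D1) (C2 : coordinatisation D2)
    (a : letter2 E) (x : crd_grp C1 * dual_group (crd_grp C2)) : Prop :=
  match a with
  | inl b => letter_val b x.1 /\ x.2 = 1
  | inr b => x.1 = 1 /\ @letter_val _ _ _ C2 b x.2
  end.

(* Model of computation: deterministic programs computing partial functions on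
   binary trees, i.e. the language WHILE of N. D. Jones (Computability and
   Complexity from a Programming Perspective) in variable-free form.  It is
   Turing complete.  A test succeeds iff its value is not [Nil]. *)
Inductive tree := Nil | Cons of tree & tree.

Inductive prog :=
| PId | PNil | PHd | PTl
| PCons of prog & prog
| PSeq of prog & prog
| PIf of prog & prog & prog
| PWhile of prog & prog.

Definition hd t := if t is Cons a _ then a else Nil.
Definition tl t := if t is Cons _ b then b else Nil.

(* [runs p x y]: on input [x], [p] halts with output [y]. *)
Inductive runs : prog -> tree -> tree -> Prop :=
| runs_id x : runs PId x x
| runs_nil x : runs PNil x Nil
| runs_hd x : runs PHd x (hd x)
| runs_tl x : runs PTl x (tl x)
| runs_cons p q x y z : runs p x y -> runs q x z ->
    runs (PCons p q) x (Cons y z)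
| runs_seq p q x y z : runs p x y -> runs q y z -> runs (PSeq p q) x z
| runs_if_true c p q x a b y : runs c x (Cons a b) -> runs p x y ->
    runs (PIf c p q) x y
| runs_if_false c p q x y : runs c x Nil -> runs q x y ->
    runs (PIf c p q) x y
| runs_while_stop c p x : runs c x Nil -> runs (PWhile c p) x x
| runs_while_step c p x a b y z : runs c x (Cons a b) -> runs p x y ->
    runs (PWhile c p) y z -> runs (PWhile c p) x z.

Definition enc_nat (n : nat) : tree := iter n (Cons Nil) Nil.
Definition enc_bool (b : bool) : tree := if b then Cons Nil Nil else Nil.
Definition enc_option T (enc : T -> tree) (o : option T) : tree :=
  if o is Some x then Cons (enc x) Nil else Nil.
Definition enc_seq T (enc : T -> tree) (s : seq T) : tree :=
  foldr (fun x t => Cons (enc x) t) Nil s.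

Section Encodings.
Variable E : finType.

Definition enc_elt (e : E) : tree := enc_nat (enum_rank e).

Definition enc_biordered (B : biordered E) : tree :=
  enc_seq (fun e => enc_seq (fun f => enc_option enc_elt (bop B e f)) (enum E))
    (enum E).

(* A biordered set together with some of its elements. *)
Definition enc_input (B : biordered E) (s : seq E) : tree :=
  Cons (enc_biordered B) (enc_seq enc_elt s).

Definition enc_letter (a : letter E) : tree :=
  Cons (enc_elt a.1) (enc_bool a.2).

Definition enc_letter2 (a : letter2 E) : tree :=
  match a with
  | inl b => Cons (enc_bool false) (enc_letter b)
  | inr b => Cons (enc_bool true) (enc_letter b)
  end.

Definition enc_relators (rels : seq (relator E)) : tree :=
  enc_seq (fun r => Cons (enc_seq enc_letter r.1) (enc_seq enc_letter r.2)) rels.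

Fixpoint enc_ratexp (r : ratexp (letter2 E)) : tree :=
  match r with
  | RVoid => Cons (enc_nat 0) Nil
  | REps => Cons (enc_nat 1) Nil
  | RSym a => Cons (enc_nat 2) (enc_letter2 a)
  | RUnion r s => Cons (enc_nat 3) (Cons (enc_ratexp r) (enc_ratexp s))
  | RProd r s => Cons (enc_nat 4) (Cons (enc_ratexp r) (enc_ratexp s))
  | RStar r => Cons (enc_nat 5) (enc_ratexp r)
  end.

End Encodings.

(* A coordinatisation chosen for every regular D-class of every IG(B), such
   that finite presentations of the groups over the generators [fgen i l] can
   be computed from [B] and (the name of) any idempotent of the D-class. *)
Definition coordinates_system :=
  forall (E : finType) (B : biordered E) (D : regDclass (IG B)),
    coordinatisation D.

Definition computably_presented (crds : coordinates_system) :=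
  exists p : prog, forall (E : finType) (B : biordered E)
    (D : regDclass (IG B)) (d : E), dcls D (ig_gen B d) ->
  exists2 rels, presents (crds E B D) rels &
    runs p (enc_input B [:: d]) (enc_relators rels).

(* For [s : 'I_m] (a gap in a sequence of length [m + 1]), the positions just
   before and just after the gap. *)
Definition before m (s : 'I_m) : 'I_m.+1 := widen_ord (leqnSn m) s.
Definition after m (s : 'I_m) : 'I_m.+1 := lift ord0 s.

(* The positive instances of the problem P, for the [m + 1] groups
   [G 0, ..., G m].  The unknowns are the [x k] with [0 < k < m]; the exceptional
   first and last conditions (and [a = b] when there is one group only) are the
   generic ones under the boundary values imposed on [x]. *)
Definition problemP m (G : 'I_m.+1 -> groupType)
    (rho : forall s : 'I_m, set (G (before s) * dual_group (G (after s))))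
    (a b : forall k, G k) : Prop :=
  exists x : forall k, G k,
  [/\ x ord0 = 1, x ord_max = b ord_max * (a ord_max)^-1 &
      forall s : 'I_m,
        rho s ((a (before s))^-1 * (x (before s))^-1 * b (before s),
               x (after s) : dual_group _)].

(* Main.v *)
Require Import Defs.
From mathcomp Require Import all_boot.
From mathcomp Require Import boolp classical_sets functions cardinality.
From HB Require Import structures.
From mathcomp Require Import generic_quotient zify.

(** Work in the monoid [M] of all words over [E] modulo the relations of
    IG(E), and write [x R y], [x L y] for Green's relations of [M].

    A letter [s] of a word [a ++ s :: b] is a seed if [a s L s R s b].  A word
    with a seed represents a regular element, and having a seed is invariant
    under the defining relations ([seeded_step], [seeded_stepV]).  More is
    true: cut a word into seeded blocks and apply a relation across a cut.
    Then either the two blocks merge into a seeded one, or the cut can first be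
    moved by one letter without changing the R-class of the left block or the
    L-class of the right one ([straddle]).  Two facts follow.

    Idempotents of IG(E) are generators ([ig1_idem]).  If [x = w] is
    idempotent, then [x] is also the product of a high power of [w], and
    still splits into as many seeded blocks as [w] has letters; so some block
    contains long stretches of powers of [w], and its seed is a letter [s] of
    [w] = [a s b] with [s b x a s = s].  Such a letter forces [x] to be the
    generator that has the same image as [x] in a semigroup from which the
    biordered set comes.  Hence regular elements are exactly those represented
    by seeded words ([regular_seeded]).

    Two irreducible sequences with the same product are connected by shifts
    [(r z, r') <-> (r, z r')] with [r z R r] and [z r' L r']
    ([irreducible_linked]).  A merge would contradict irreducibility, so each
    rewriting step on the word of the product costs at most one shift
    ([word_step]); and two irreducible splittings of one and the same word
    differ by shifts, because the seeds of corresponding blocks lie in their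
    overlap ([same_word]).

    In coordinates a shift by a generator [e] at the gap between [D_s] and
    [D_(s+1)] moves a pair (L-class, R-class), multiplies the group coordinate
    of the left neighbour on the right, and that of the right neighbour on the
    left ([step_letter]).  The idempotents [h], [he] with [eh = h] in the
    L-class, and [h'], [eh'] with [h'e = h'] in the R-class, express both
    factors through the generators of the groups.  So [rho] is the set of
    labels of walks in a finite graph labelled by
    [G_s * dual_group G_(s+1)] ([rho], [equal_linked], [linked_equal]).

    Every edge has an inverse, so each walk label is a product of labels of
    short closed walks followed by the label of a short walk; this gives the
    rational expression [rho_exp] ([denotes_rho]).  It is produced by bounded
    iteration over the table of the biordered set, hence by a program
    ([comp_trho], [trho_rho]). *)

Set Implicit Arguments.
Unset Strict Implicit.
Unset Printing Implicit Defensive.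

Local Open Scope classical_set_scope.
Local Open Scope group_scope.

(** * The monoid of words and the idempotents it comes from *)

Section FreeMonoid.
Variables (E : finType) (B : biordered E).

(** With the empty word included, left and right divisibility become the
    existence of a factor, and blocks of a word can be cut off freely. *)
Definition ig1R : rel (seq E) := fun u v => `[< ig_eq B u v >].

Lemma ig1R_refl : reflexive ig1R.
Proof. by move=> u; apply/asboolP; apply: ig_refl. Qed.
Lemma ig1R_sym : symmetric ig1R.
Proof. by move=> u v; apply/asboolP/asboolP; apply: ig_sym. Qed.
Lemma ig1R_trans : transitive ig1R.
Proof.
by move=> v u w /asboolP h1 /asboolP h2; apply/asboolP; exact: ig_trans h1 h2.
Qed.

Canonical ig1R_rel := EquivRel ig1R ig1R_refl ig1R_sym ig1R_trans.

Local Open Scope quotient_scope.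

Definition IG1 := {eq_quot ig1R}.
HB.instance Definition _ := EqQuotient.on IG1.
HB.instance Definition _ := Choice.on IG1.

Definition ev (w : seq E) : IG1 := \pi_IG1 w.

Lemma evP u v : ev u = ev v <-> ig_eq B u v.
Proof. by split=> [/eqmodP/asboolP //|h]; apply/eqmodP/asboolP. Qed.

Lemma evK x : ev (repr x) = x.
Proof. exact: reprK. Qed.

Definition ig1_mul (x y : IG1) : IG1 := ev (repr x ++ repr y).

Lemma ev_cat_mul u v : ev (u ++ v) = ig1_mul (ev u) (ev v).
Proof. by apply/evP/ig_cat; apply/evP; rewrite evK. Qed.

Lemma ig1_mulA : associative ig1_mul.
Proof.
by move=> x y z; rewrite -(evK x) -(evK y) -(evK z) -!ev_cat_mul catA.
Qed.
Lemma ig1_mul1 : left_id (ev [::]) ig1_mul.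
Proof. by move=> x; rewrite -(evK x) -ev_cat_mul. Qed.
Lemma ig1_mul1r : right_id (ev [::]) ig1_mul.
Proof. by move=> x; rewrite -(evK x) -ev_cat_mul cats0. Qed.

HB.instance Definition _ := isMonoid.Build IG1 ig1_mulA ig1_mul1 ig1_mul1r.

Lemma ev_cat u v : ev (u ++ v) = ev u * ev v.
Proof. exact: ev_cat_mul. Qed.
Lemma ev_nil : ev [::] = 1. Proof. by []. Qed.

Definition gn (e : E) : IG1 := ev [:: e].

Lemma ev_cons e u : ev (e :: u) = gn e * ev u.
Proof. by rewrite -cat1s ev_cat. Qed.

Lemma bop_gn e f g : bop B e f = Some g -> gn e * gn f = gn g.
Proof. by move=> h; rewrite -ev_cat; apply/evP; exact: (@ig_rel _ _ [::] [::]). Qed.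

Lemma ig_eq_nil u v : ig_eq B u v -> (u == [::]) = (v == [::]).
Proof.
by elim=> // [? ? ? _ ? _|]; [congruence | move=> [|? ?] ? ? ? ? ?].
Qed.

(** The relations never erase a word. This separates the elements of the
    semigroup from the adjoined identity. *)
Lemma ev_eq1 u : ev u = 1 -> u = [::].
Proof. by rewrite -ev_nil => /evP/ig_eq_nil; rewrite eqxx => /eqP. Qed.

End FreeMonoid.

Section Adjoin.
Variable S : semigroupType.
(** The monoid [S^1], target of the homomorphism from the monoid of words. *)
Definition adjoin1 := option S.
HB.instance Definition _ := Choice.on adjoin1.
Definition adj_mul (x y : adjoin1) : adjoin1 :=
  match x, y with Some a, Some b => Some (a * b) | None, _ => y | _, None => x end.
Lemma adj_mulA : associative adj_mul.
Proof. by case=> [a|] [b|] [c|] //=; rewrite mulgA. Qed.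
Lemma adj_mul1 : left_id None adj_mul. Proof. by case. Qed.
Lemma adj_mul1r : right_id None adj_mul. Proof. by case. Qed.
HB.instance Definition _ := isMonoid.Build adjoin1 adj_mulA adj_mul1 adj_mul1r.
Lemma some_mul (x y : S) : Some (x * y) = (Some x : adjoin1) * (Some y : adjoin1).
Proof. by []. Qed.
End Adjoin.

Section Representation.
Variables (E : finType) (B : biordered E).
Local Notation M := (IG1 B).
Local Notation gn := (gn B).
Local Notation ev := (ev B).

(** The semigroup that the biordered set comes from represents the monoid of
    words. Idempotents of the monoid map to images of generators, and a
    product of two generators forming a basic pair can be computed in the
    image: equations of this kind lift back, which is the source of all
    equations in the free object that are not given by the presentation. *)
Lemma ig_rep : exists (N : monoidType) (Phi : M -> N),
  [/\ {morph Phi : x y / x * y}, injective (Phi \o gn),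
      forall x, x != 1 -> x * x = x -> exists e, Phi x = Phi (gn e) &
      forall e f g, bop B e f = Some g <->
        basic_pair (Phi (gn e)) (Phi (gn f)) /\
        Phi (gn e) * Phi (gn f) = Phi (gn g)].
Proof.
have [S [phi [phi_inj phi_idem phi_bop]]] := bopP B.
pose N : monoidType := adjoin1 S.
pose F (w : seq E) : N := \prod_(e <- w) (Some (phi e) : N).
have F1 e : F [:: e] = Some (phi e) by rewrite /F big_seq1.
have FE u v : ig_eq B u v -> F u = F v.
  elim=> // [? ? ? _ -> _ //|{}u {}v e f g /phi_bop[_ efg]].
  rewrite /F !big_cat /= !big_cons !big_nil !mulg1; congr (_ * (_ * _)).
  by rewrite -efg.
pose Phi (x : M) := F (repr x).
have PhiE w : Phi (ev w) = F w by apply: FE; apply/evP; rewrite evK.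
have PhiG e : Phi (gn e) = Some (phi e) by rewrite PhiE F1.
exists N, Phi; split.
- move=> x y; rewrite -(evK x) -(evK y) -ev_cat !PhiE.
  by rewrite /F big_cat.
- by move=> e f /=; rewrite !PhiG => -[/phi_inj].
- move=> x x1 xx.
  have : Phi x * Phi x = Phi x.
    rewrite -{3}xx -(evK x) -ev_cat !PhiE; by rewrite /F big_cat.
  have : exists s : S, Phi x = Some s.
    rewrite /Phi; case E1: (repr x) x1 => [|e w]; first by rewrite -(evK x) E1 eqxx.
    move=> _; rewrite /F big_cons.
    by case: (\prod_(_ <- w) _) => [s|]; [exists (phi e * s)|exists (phi e)].
  move=> [s ->] [/phi_idem [e ->]]; by exists e; rewrite PhiG.
- move=> e f g; rewrite !PhiG phi_bop.
  rewrite /basic_pair -!some_mul; split=> -[h1 h2]; split.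
  + by case: h1 => ->; [apply: Or41|apply: Or42|apply: Or43|apply: Or44].
  + by rewrite h2.
  + by case: h1 => -[->]; [apply: Or41|apply: Or42|apply: Or43|apply: Or44].
  + by case: h2.
Qed.

(** The table of the biordered set can be read off the free object itself, so
    the representing semigroup can be forgotten from here on, except where
    idempotents are identified. *)
Lemma bopE e f g : bop B e f = Some g <->
  basic_pair (gn e) (gn f) /\ gn e * gn f = gn g.
Proof.
have [N [Phi [PM Pinj Pid Pbop]]] := ig_rep.
have key a b c : basic_pair (Phi (gn a)) (Phi (gn b)) ->
    Phi (gn a) * Phi (gn b) = Phi (gn c) -> gn a * gn b = gn c.
  by move=> h1 h2; apply: bop_gn; apply/Pbop.
split=> [h|[h1 h2]]; last first.
  apply/Pbop; split; last by rewrite -PM h2.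
  by case: h1 => h; [apply: Or41|apply: Or42|apply: Or43|apply: Or44];
    rewrite -PM h.
split; last exact: bop_gn.
have [h1 h2] := (Pbop e f g).1 h.
have bsym (x y : N) : basic_pair x y -> basic_pair y x.
  by case=> ?; [apply: Or44|apply: Or43|apply: Or42|apply: Or41].
case: (h1) => h3; [apply: Or41|apply: Or42|apply: Or43|apply: Or44];
  by apply: key => //; apply: bsym.
Qed.

Lemma gn_idem e : gn e * gn e = gn e.
Proof.
have [S [phi [phi_inj phi_idem phi_bop]]] := bopP B.
apply: bop_gn; apply/phi_bop.
have h : phi e * phi e = phi e by apply/phi_idem; exists e.
by split=> //; apply: Or41.
Qed.

End Representation.

(** * Seeds *)

Section MonoidGreen.
Variable M : monoidType.
Implicit Types x y z : M.

(** Says that [x] and [x y] are R-related, by way of a factor that recovers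
    [x] from [x y]. *)
Definition rc x y := exists q, x * (y * q) = x.
(** Says that [x] and [y x] are L-related. *)
Definition lc y x := exists p, p * y * x = x.

Lemma rcM x y z : rc x y -> rc (x * y) z -> rc x (y * z).
Proof.
by move=> [q xyq] [r h]; exists (r * q); rewrite !mulgA in h xyq *; rewrite h.
Qed.
Lemma lcM x y z : lc y x -> lc z (y * x) -> lc (z * y) x.
Proof.
move=> [q xyq] [r h]; exists (q * r); rewrite -!mulgA in h xyq *.
by rewrite h.
Qed.
Lemma rcMl x y z : rc x (y * z) -> rc x y.
Proof. by move=> [q h]; exists (z * q); rewrite !mulgA in h *. Qed.
Lemma lcMr x y z : lc (z * y) x -> lc y x.
Proof. by move=> [q h]; exists (q * z); rewrite !mulgA in h *. Qed.
Lemma rcMr x y z : rc x (y * z) -> rc (x * y) z.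
Proof. by move=> [q h]; exists (q * y); rewrite !mulgA in h *; rewrite h. Qed.
Lemma lcMl x y z : lc (z * y) x -> lc z (y * x).
Proof.
by move=> [q h]; exists (y * q); rewrite -!mulgA in h *; rewrite h.
Qed.
Lemma rc_mul z x y : rc x y -> rc (z * x) y.
Proof. by move=> [q h]; exists q; rewrite -!mulgA h. Qed.
Lemma lc_mul z x y : lc y x -> lc y (x * z).
Proof. by move=> [q h]; exists q; rewrite !mulgA h. Qed.
Lemma rc1 x : rc x 1. Proof. by exists 1; rewrite !mulg1. Qed.
Lemma lc1 x : lc 1 x. Proof. by exists 1; rewrite !mul1g. Qed.

(** Regularity in the monoid; for elements of the subsemigroup it coincides
    with regularity there. *)
Definition regular x := exists y, x * y * x = x.

Lemma regular_rc x y : rc x y -> regular x -> regular (x * y).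
Proof.
move=> [q h] [t xtx]; exists (q * t); rewrite !mulgA in h *.
by rewrite h xtx.
Qed.
Lemma regular_lc x y : lc y x -> regular x -> regular (y * x).
Proof.
move=> [q h] [t xtx]; exists (t * q); rewrite -!mulgA in h xtx *.
by rewrite h xtx.
Qed.
Lemma regular_rcV x y : rc x y -> regular (x * y) -> regular x.
Proof.
move=> [q h] [t xtx]; exists (y * t); rewrite !mulgA in h xtx *.
by rewrite -[in X in _ * X]h !mulgA xtx.
Qed.
Lemma regular_lcV x y : lc y x -> regular (y * x) -> regular x.
Proof.
move=> [q h] [t xtx]; exists (t * y); rewrite -!mulgA in h xtx *.
by rewrite -[in X in X * _]h -!mulgA xtx.
Qed.
End MonoidGreen.

Section Seeds.
Variables (E : finType) (B : biordered E).
Local Notation M := (IG1 B).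
Local Notation gn := (gn B).
Local Notation ev := (ev B).
Implicit Types u v w a b c d : seq E.

(** A seed sees both sides of the word absorbed into its own D-class: the
    product of the word is in the R-class of [a s] and in the L-class of [s
    b]. *)
Definition seed a s b := lc (ev a) (gn s) /\ rc (gn s) (ev b).
Definition seeded w := exists a s b, w = a ++ s :: b /\ seed a s b.

Lemma seed_regular a s b : seed a s b -> regular (ev (a ++ s :: b)).
Proof.
move=> [h1 h2]; rewrite ev_cat ev_cons mulgA; apply: regular_rc.
  exact: rc_mul.
by apply: regular_lc => //; exists (gn s); rewrite !gn_idem.
Qed.

Lemma seeded_regular w : seeded w -> regular (ev w).
Proof. by move=> [a [s [b [-> /seed_regular]]]]. Qed.

Lemma cat_split (T : Type) (a b c d : seq T) : a ++ b = c ++ d ->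
  (exists z, c = a ++ z /\ b = z ++ d) \/ (exists z, a = c ++ z /\ d = z ++ b).
Proof.
elim: a c => [|x a IH] [|y c] /= h.
- by left; exists [::].
- by left; exists (y :: c).
- by right; exists (x :: a).
- case: h => <- /IH[[z [-> ->]]|[z [-> ->]]]; [left|right]; by exists z.
Qed.

Lemma seed_ev a a' s b b' : ev a = ev a' -> ev b = ev b' -> seed a s b -> seed a' s b'.
Proof. by rewrite /seed => -> ->. Qed.

(** If one of the two letters of the redex is the seed, their product [ef]
    inherits the role: a factor that cancels [f] or [e] cancels it in [ef] as
    well. A seed elsewhere does not notice the relation. *)
Lemma seeded_step u v e f g : bop B e f = Some g ->
  seeded (u ++ [:: e; f] ++ v) -> seeded (u ++ [:: g] ++ v).
Proof.
move=> /bop_gn efg [a [s [b [h sd]]]].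
have [[z [az bz]]|[[|x z] [uz bz]]] := cat_split h.
- case: z az bz => [|x z] az /= bz.
    rewrite cats0 in az; case: bz => ? bz; subst.
    exists u, g, v; split => //; case: sd => -[p h1] [q h2].
    split.
      by exists p; rewrite -efg mulgA h1.
    exists (q * gn s * gn f); move: h2; rewrite ev_cons -efg !mulgA => h2.
    by rewrite h2 gn_idem.
  case: bz => ? bz; subst x.
  case: z az bz => [|y z] az /= bz.
    case: bz => ? bz; subst.
    exists u, g, b; split => //; case: sd => -[p h1] [q h2].
    split; last by exists q; rewrite -efg -!mulgA h2.
    exists (gn e * p); move: h1; rewrite ev_cat -efg !mulgA => h1.
    rewrite -!mulgA in h1 *; congr (_ * _); exact: h1.
  case: bz => ? bz; subst.
  exists (u ++ g :: z), s, b; split; first by rewrite -catA.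
  by apply: seed_ev sd => //; rewrite !ev_cat !ev_cons -efg !mulgA.
- rewrite cats0 /= in uz bz; case: bz => ? bz; subst.
  exists a, g, v; split => //; case: sd => -[p h1] [q h2].
  split.
    by exists p; rewrite -efg mulgA h1.
  exists (q * gn e * gn f); move: h2; rewrite ev_cons -efg !mulgA => h2.
  by rewrite h2 gn_idem.
- case: bz => ? bz; subst.
  exists a, x, (z ++ g :: v); split; first by rewrite -catA.
  by apply: seed_ev sd => //; rewrite !ev_cat !ev_cons -efg !mulgA.
Qed.

(** Here it matters that the pair is basic: [ef] is then R-related to [e] or
    L-related to [f], so a seed [ef] passes its role to that letter. *)
Lemma seeded_stepV u v e f g : bop B e f = Some g ->
  seeded (u ++ [:: g] ++ v) -> seeded (u ++ [:: e; f] ++ v).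
Proof.
move=> /bopE [bs efg] [a [s [b [h sd]]]].
have caseg : seed u g v -> seeded (u ++ [:: e; f] ++ v).
  move=> [[p h1] [q h2]].
  have [ge|gf] : gn g * gn e = gn e \/ gn f * gn g = gn f.
  - case: bs => h3; [left|right|left|right]; rewrite -efg.
    + by rewrite h3 gn_idem.
    + by rewrite h3 gn_idem.
    + by rewrite -mulgA h3 gn_idem.
    + by rewrite mulgA h3 gn_idem.
  - exists u, e, (f :: v); split=> //; split.
      by exists p; rewrite -ge mulgA h1.
    exists (q * gn e); rewrite ev_cons !mulgA efg; rewrite !mulgA in h2.
    by rewrite h2 ge.
  - exists (u ++ [:: e]), f, v; split; first by rewrite -catA.
    split.
      exists (gn f * p); rewrite ev_cat -!mulgA efg.
      by rewrite -mulgA in h1; rewrite h1.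
    by exists q; rewrite -{1}gf -mulgA h2.
have [[z [az bz]]|[[|x z] [uz bz]]] := cat_split h.
- case: z az bz => [|x z] az /= bz.
    rewrite cats0 in az; case: bz => ? bz; subst; exact: caseg.
  case: bz => ? bz; subst.
  exists (u ++ e :: f :: z), s, b; split; first by rewrite -catA.
  by apply: seed_ev sd => //; rewrite !ev_cat !ev_cons -efg !mulgA.
- rewrite cats0 /= in uz bz; case: bz => ? bz; subst; exact: caseg.
- case: bz => ? bz; subst.
  exists a, x, (z ++ e :: f :: v); split; first by rewrite -catA.
  by apply: seed_ev sd => //; rewrite !ev_cat !ev_cons -efg !mulgA.
Qed.

Lemma seeded_ig u v : ig_eq B u v -> seeded u <-> seeded v.
Proof.
elim=> // [? ? _ IH|? ? ? _ IH1 _ IH2|{}u {}v e f g h].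
- by split=> /IH.
- by split=> [/IH1/IH2|/IH2/IH1].
- by split; [apply: seeded_step|apply: seeded_stepV].
Qed.

Lemma seeded_ev u v : ev u = ev v -> seeded u <-> seeded v.
Proof. by move/evP/seeded_ig. Qed.

(** A redex [e f] lies across the boundary of two seeded blocks. As the pair
    is basic, [ef R e] or [ef L f]. In the first case [f] may join the left
    block without changing its R-class. What remains of the right block keeps
    its seed unless the seed was [f]; but then all of the right block is
    absorbed by the left one, whose seed serves for the union. The second case
    is dual. *)
Lemma straddle a e f b g : bop B e f = Some g ->
  seeded (a ++ [:: e]) -> seeded (f :: b) ->
  [\/ seeded (a ++ [:: e; f] ++ b),
      [/\ seeded b, rc (ev (a ++ [:: e])) (gn f) & lc (gn f) (ev b)] |
      [/\ seeded a, rc (ev a) (gn e) & lc (gn e) (ev (f :: b))]].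
Proof.
move=> /bopE [bs efg] [a1 [s [a2 [ea sda]]]] [b1 [t [b2 [eb sdb]]]].
have [ge|gf] : rc (gn e) (gn f) \/ lc (gn e) (gn f).
- case: bs => h3; [left|right|left|right].
  + by exists 1; rewrite mulg1 h3.
  + by exists 1; rewrite mul1g h3.
  + by exists (gn e); rewrite h3 gn_idem.
  + by exists (gn f); rewrite h3 gn_idem.
- case: b1 eb sdb => [|x b1] [? eb] [l1 l2]; subst.
    apply: Or31; exists a1, s, (a2 ++ t :: b2); split.
      have -> : a ++ [:: e; t] ++ b2 = (a ++ [:: e]) ++ t :: b2 by rewrite -catA.
      by rewrite ea -catA.
    case: sda => h1 h2; split=> //; rewrite ev_cat ev_cons; apply: rcM => //.
    apply: rcM; last exact: rc_mul.
    move: ea; rewrite -ev_cons (lastI s) cats1 -rcons_cat => /rcons_inj[_ <-].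
    by rewrite -cats1 ev_cat; apply: rc_mul.
  apply: Or32; split.
  + by exists b1, t, b2; split=> //; split=> //; move: l1; rewrite ev_cons => /lcMr.
  + by rewrite ev_cat; apply: rc_mul.
  + rewrite ev_cat ev_cons mulgA; apply: lc_mul.
    by apply: lcMl; rewrite -ev_cons.
- case/lastP: a2 ea sda => [|a2 x] ea [l1 l2].
    move: ea; rewrite !cats1 => /rcons_inj [? ?]; subst a1 s.
    apply: Or31; exists (a ++ e :: b1), t, b2; split.
      by rewrite /= eb -catA.
    case: sdb => h1 h2; split=> //; rewrite ev_cat ev_cons.
    have h3 : lc (gn e) (ev b1 * gn t).
      case: b1 eb {h1} => [|y b1] [<- _]; first by rewrite mul1g.
      by rewrite ev_cons -mulgA; apply: lc_mul.
    by apply: lcM; [exact: lcM|rewrite -mulgA; exact: lc_mul].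
  move: ea; rewrite cats1 -rcons_cons -rcons_cat => /rcons_inj [ea ?]; subst a x.
  rewrite -cats1 ev_cat in l2.
  apply: Or33; split.
  + by exists a1, s, a2; split=> //; split=> //; apply: rcMl l2.
  + by rewrite ev_cat ev_cons mulgA -mulgA; apply/rc_mul/rcMr.
  + by rewrite ev_cons; apply: lc_mul.
Qed.
End Seeds.

(** * Splittings into seeded blocks *)

Section Splittings.
Variables (E : finType) (B : biordered E).
Local Notation M := (IG1 B).
Local Notation gn := (gn B).
Local Notation ev := (ev B).
Local Notation seeded := (seeded B).
Implicit Types u v w a b c d : seq E.
Implicit Types us vs : seq (seq E).

Lemma seeded_rc w v : seeded w -> rc (ev w) (ev v) -> seeded (w ++ v).
Proof.
move=> [a [s [b [-> [[p h1] h2]]]]] [q h].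
exists a, s, (b ++ v); split; first by rewrite -catA.
split; first by exists p.
rewrite ev_cat; apply: rcM => //; exists q.
move: h; rewrite ev_cat ev_cons !mulgA => h; move/(congr1 ( *%g p)): h.
by rewrite !mulgA h1.
Qed.

Lemma seeded_lc w v : seeded w -> lc (ev v) (ev w) -> seeded (v ++ w).
Proof.
move=> [a [s [b [-> [h1 [p h2]]]]]] [q h].
exists (v ++ a), s, b; split; first by rewrite -catA.
split; last by exists p.
rewrite ev_cat; apply: lcM => //; exists q.
move: h; rewrite ev_cat ev_cons !mulgA => /(congr1 ( *%g^~ p)).
by rewrite -!mulgA h2.
Qed.

Lemma seeded_nil : ~ seeded [::].
Proof. by move=> [[|? ?] [? [? []]]]. Qed.

Definition all_seeded us := forall u, u \in us -> seeded u.

Lemma all_seeded_cat us vs :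
  all_seeded (us ++ vs) <-> all_seeded us /\ all_seeded vs.
Proof.
split=> [h|[h1 h2] u].
  by split=> u hu; apply: h; rewrite mem_cat hu ?orbT.
by rewrite mem_cat => /orP[/h1|/h2].
Qed.
Lemma all_seeded_cons u us :
  all_seeded (u :: us) <-> seeded u /\ all_seeded us.
Proof.
split=> [h|[h1 h2] v].
  by split=> [|v hv]; apply: h; rewrite inE ?eqxx ?hv ?orbT.
by rewrite inE => /orP[/eqP->|/h2].
Qed.

Lemma flatten_locate us a g b : flatten us = a ++ g :: b ->
  exists us1 u1 u2 us2, [/\ us = us1 ++ (u1 ++ g :: u2) :: us2,
    a = flatten us1 ++ u1 & b = u2 ++ flatten us2].
Proof.
elim: us a => [[]//|u us IH] a /= h.
have [[z [-> /IH[us1 [u1 [u2 [us2 [-> -> ->]]]]]]]|[[|y z] [uz bz]]] := cat_split h.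
- by exists (u :: us1), u1, u2, us2; rewrite /= catA.
- have /IH[us1 [u1 [u2 [us2 [-> h2 ->]]]]] : flatten us = [::] ++ g :: b by [].
  by exists (u :: us1), u1, u2, us2; split=> //=; rewrite -catA -h2 uz cats0 cats0.
- case: bz => ? ->; subst y; by exists [::], a, z, us; rewrite -uz.
Qed.

(** The boundary of two blocks moves over [z] while the left block stays in
    its R-class and the right block in its L-class. *)
Definition word_shift us vs := exists l1 r z r' l2,
  [/\ us = l1 ++ [:: r ++ z; r'] ++ l2, vs = l1 ++ [:: r; z ++ r'] ++ l2,
      rc (ev r) (ev z) & lc (ev z) (ev r')].

(** Every redex can be brought inside a single block, at the price of one
    shift or of one merge of two blocks. *)
Lemma pair_locate us a e f b g : bop B e f = Some g -> all_seeded us ->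
  flatten us = a ++ e :: f :: b ->
  exists us1 u1 u2 us2, let us' := us1 ++ (u1 ++ e :: f :: u2) :: us2 in
    [/\ all_seeded us', a = flatten us1 ++ u1, b = u2 ++ flatten us2 &
     [\/ us' = us, word_shift us us', word_shift us' us |
       exists x y, us = us1 ++ x :: y :: us2 /\ u1 ++ e :: f :: u2 = x ++ y]].
Proof.
move=> efg sd /flatten_locate[us1 [u1 [[|x u2] [us2 [E1 -> E2]]]]]; last first.
  case: E2 E1 => -> -> E1.
  by exists us1, u1, u2, us2; split=> //; [rewrite -E1|apply: Or41].
case: us2 E1 E2 => [|[|x u2] us2] E1 //= E2.
  case: seeded_nil; apply: sd; rewrite E1 mem_cat !inE eqxx ?orbT //.
case: E2 => fx ->; subst x; subst us.
move: sd => /all_seeded_cat [h1] /all_seeded_cons [h2] /all_seeded_cons [h3 h4].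
have E3 : u1 ++ e :: f :: u2 = (u1 ++ [:: e]) ++ f :: u2 by rewrite -catA.
have [h5|[h5 h6 h7]|[h5 h6 h7]] := straddle efg h2 h3.
- exists us1, u1, u2, us2; split=> //.
    by apply/all_seeded_cat; split=> //; apply/all_seeded_cons.
  by apply: Or44; exists (u1 ++ [:: e]), (f :: u2).
- exists us1, u1, [::], (u2 :: us2); split=> //.
    apply/all_seeded_cat; split=> //; apply/all_seeded_cons; split.
      have -> : u1 ++ [:: e; f] = (u1 ++ [:: e]) ++ [:: f] by rewrite -catA.
      exact: seeded_rc.
    by apply/all_seeded_cons.
  apply: Or43; exists us1, (u1 ++ [:: e]), [:: f], u2, us2; split=> //.
  by rewrite -catA.
- exists (us1 ++ [:: u1]), [::], u2, us2; split=> //.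
  + rewrite -catA; apply/all_seeded_cat; split=> //; apply/all_seeded_cons; split=> //.
    apply/all_seeded_cons; split=> //=.
    by rewrite -cat1s; apply: seeded_lc.
  + by rewrite flatten_cat /= !cats0.
  + by apply: Or42; exists us1, u1, [:: e], (f :: u2), us2; split; rewrite -?catA.
Qed.

(** The least such [k] turns out to depend only on the element that [w]
    represents. *)
Definition nsplit k w := exists us, [/\ size us <= k, all_seeded us & flatten us = w]%N.

(** Replacing a redex inside a block preserves seeds, and bringing it inside a
    block never creates a new block. *)
Lemma nsplit_ig k u v : ig_eq B u v -> nsplit k u <-> nsplit k v.
Proof.
elim=> // [? ? _ IH|? ? ? _ IH1 _ IH2|{}u {}v e f g h].
- by split=> /IH.
- by split=> [/IH1/IH2|/IH2/IH1].
- split=> -[us [k_us sd fl]].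
  + have [us1 [u1 [u2 [us2 [h1 ua vb h2]]]]] := pair_locate h sd fl.
    exists (us1 ++ (u1 ++ g :: u2) :: us2); split.
    * apply: leq_trans k_us; move: h2; rewrite !size_cat /=.
      case=> [<-|[l1 [? [? [? [? [-> /(congr1 size)]]]]]]|
              [l1 [? [? [? [? [/(congr1 size) + ->]]]]]]|[x [y [-> _]]]];
        by rewrite !size_cat /= ?size_cat //=; lia.
    * move: h1 => /all_seeded_cat[h1] /all_seeded_cons[h3 h4].
      apply/all_seeded_cat; split=> //; apply/all_seeded_cons; split=> //.
      exact: seeded_step h _.
    * by rewrite flatten_cat /= ua vb -!catA.
  + have [us1 [u1 [u2 [us2 [h1 ua vb]]]]] := flatten_locate fl.
    exists (us1 ++ (u1 ++ e :: f :: u2) :: us2); subst us; split.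
    * by move: k_us; rewrite !size_cat.
    * move: sd => /all_seeded_cat[h1] /all_seeded_cons[h3 h4].
      apply/all_seeded_cat; split=> //; apply/all_seeded_cons; split=> //.
      exact: seeded_stepV h _.
    * by rewrite flatten_cat /= ua vb -!catA.
Qed.

(** Single letters are idempotent, hence their own seeds. *)
Lemma nsplit_size w : nsplit (size w) w.
Proof.
exists [seq [:: e] | e <- w]; split.
- by rewrite size_map.
- move=> _ /mapP[e _ ->]; exists [::], e, [::]; split=> //; split.
    exact: lc1.
  exact: rc1.
- by elim: w => //= e w ->.
Qed.

Definition wpow w n := flatten (nseq n w).

Lemma wpow_split w n c s d : wpow w n = c ++ s :: d ->
  exists a b i j, [/\ w = a ++ s :: b, c = wpow w i ++ a & d = b ++ wpow w j].
Proof.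
rewrite /wpow; elim: n c => [[]//|n IH] c /= h.
have [[z [-> /IH[a [b [i [j [E1 -> ->]]]]]]]|[[|y z] [uz bz]]] := cat_split h.
- by exists a, b, i.+1, j; rewrite -?E1 /= catA.
- have /IH[a [b [i [j [E1 h2 ->]]]]] : flatten (nseq n w) = [::] ++ s :: d by [].
  exists a, b, i.+1, j; split=> //=; by rewrite -catA -h2 uz !cats0.
- case: bz => ? ->; subst y; by exists c, z, 0, n.
Qed.

Lemma size_flatten_bound us k : (forall u, u \in us -> size u < k)%N ->
  (size (flatten us) <= size us * k)%N.
Proof.
elim: us => //= u us IH h; rewrite size_cat mulSn leq_add //.
  by apply/ltnW/h; rewrite inE eqxx.
by apply: IH => v hv; apply: h; rewrite inE hv orbT.
Qed.

End Splittings.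

(** * Idempotents of the free object are generators *)

Section Easdown.
Variables (E : finType) (B : biordered E).
Local Notation M := (IG1 B).
Local Notation gn := (gn B).
Local Notation ev := (ev B).
Local Notation seeded := (seeded B).
Implicit Types u v w a b c d : seq E.

Lemma ev_wpow w n : ev w * ev w = ev w -> ev (wpow w n.+1) = ev w.
Proof.
move=> ww; elim: n => [|n IH]; first by rewrite /wpow /= cats0.
by rewrite [wpow _ _]/(w ++ wpow w n.+1) ev_cat IH.
Qed.

(** With [n = size w], the word [w^(3n+1)] represents the same element as [w],
    so it splits into at most [n] seeded blocks, one of which has length at
    least [3n]. The seed of that block has on its right the rest [b] of its
    copy of [w] and a full further copy, or symmetrically on its left. *)
Lemma long_block w : w <> [::] -> ev w * ev w = ev w ->
  exists a s b, w = a ++ s :: b /\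
    (rc (gn s) (ev b * ev w) \/ lc (ev w * ev a) (gn s)).
Proof.
move=> w0 ww; set n := size w; have n0 : (0 < n)%N by rewrite lt0n size_eq0; apply/eqP.
have /nsplit_ig hn : ig_eq B w (wpow w (3 * n).+1) by apply/evP; rewrite ev_wpow.
have [us [k_us sd fl]] := (hn n).1 (nsplit_size B w).
have [[u u_us big]|small] := pselect (exists2 u, u \in us & 3 * n <= size u)%N; last first.
  have : (size (flatten us) <= size us * (3 * n))%N.
    apply: size_flatten_bound => u u_us; rewrite ltnNge; apply/negP => h.
    by apply: small; exists u.
  rewrite fl /wpow size_flatten /shape map_nseq sumn_nseq -/n; nia.
have [c' [s [d' [E2 [sd1 sd2]]]]] := sd _ u_us; subst u.
move: fl; case/splitPr: u_us {k_us sd} => us1 us2.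
rewrite flatten_cat /= -catA cat_cons catA => /esym /wpow_split.
move=> [a [b [i [j [wE cE dE]]]]]; exists a, s, b; split=> //.
move: big; rewrite size_cat /= => big.
have nE : n = (size a + (size b).+1)%N by rewrite /n wE size_cat.
(* In the second case at least [n + size a] letters precede the seed. *)
have [hd|hd] := leqP (size b + n) (size d').
- left; case: j dE => [|j]; first by rewrite cats0 => /(congr1 size); rewrite size_cat; lia.
  rewrite [wpow _ _]/(w ++ wpow w j) catA => dE.
  have [[z [bE _]]|[z [dE2 _]]] := cat_split dE.
    have z0 : z = [::].
      by apply: size0nil; move/(congr1 size): bE; rewrite !size_cat -/n; lia.
    by rewrite -ev_cat bE z0 cats0.
  by move: sd2; rewrite dE2 ev_cat ev_cat => /rcMl.
- right; case: i cE => [|i]; first by move/(congr1 size); rewrite size_cat /=; lia.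
  have -> : wpow w i.+1 = wpow w i ++ w by rewrite /wpow -[i.+1]addn1 nseqD flatten_cat /= cats0.
  rewrite -catA => cE.
  have [[z [_ cE2]]|[z [_ aE]]] := cat_split cE.
    by move: sd1; rewrite cE2 ev_cat ev_cat => /lcMr.
  have z0 : z = [::].
    by apply: size0nil; move/(congr1 size): aE; rewrite !size_cat -/n; lia.
  by rewrite -ev_cat aE z0.
Qed.

(** For a factorisation [w = a b] the element [b x a] is idempotent; let [g]
    be the generator with the same image. At a letter [s] with neighbouring
    generators [g] and [g'] the products [s g], [g' s], [g s], [s g'] are all
    basic, so the equality [g s = s g'] in the image holds in the free object.
    Therefore the generator [e] with the same image as [x] commutes past every
    letter of [w], and [e x] is R-related to [e]. The letter found by
    [long_block] satisfies [s = s b x a s], which gives [g s = s]; this makes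
    [e] act as the identity on [x], so that [x = e]. *)
Theorem ig1_idem w : w <> [::] -> ev w * ev w = ev w -> exists e, ev w = gn e.
Proof.
move=> w0 xx; have [N [Phi [PM Pinj Pid Pbop]]] := ig_rep B.
set x := ev w in xx *.
pose rel a b g := Phi (gn g) = Phi (ev b * x * ev a).
have relP a b : w = a ++ b -> exists g, rel a b g.
  move=> wE; have xE : x = ev a * ev b by rewrite -ev_cat -wE.
  have [||y] := Pid (ev b * x * ev a); last by exists y.
    apply/eqP; rewrite /x -!ev_cat => /ev_eq1; case: (w) w0 => //.
    by move=> ? ? _; case: (b).
  rewrite !mulgA -(mulgA _ (ev a)) -xE.
  by rewrite -(mulgA (ev b)) xx -(mulgA (ev b)) xx.
have step a s b g g' : w = a ++ s :: b -> rel a (s :: b) g ->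
    rel (a ++ [:: s]) b g' ->
    [/\ gn g * gn s = gn s * gn g', gn s * gn g = gn g & gn g' * gn s = gn g'].
  move=> wE rg rg'.
  have xE : x = ev a * gn s * ev b by rewrite -mulgA -ev_cons -ev_cat -wE.
  have sg : bop B s g = Some g.
    have h : Phi (gn s) * Phi (gn g) = Phi (gn g).
      by rewrite rg -PM ev_cons !mulgA gn_idem.
    by apply/Pbop; split=> //; apply: Or42.
  have gs : bop B g' s = Some g'.
    have h : Phi (gn g') * Phi (gn s) = Phi (gn g').
      by rewrite rg' -PM ev_cat -!mulgA gn_idem.
    by apply/Pbop; split=> //; apply: Or41.
  have [||f fE] := Pid (gn s * ev b * x * ev a * gn s).
    by apply/eqP; rewrite /x -[gn s]/(ev [:: s]) -!ev_cat => /ev_eq1.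
    have xE' z : ev a * (gn s * (ev b * z)) = x * z by rewrite xE -!mulgA.
    have xx' z : x * (x * z) = x * z by rewrite mulgA xx.
    by rewrite -!mulgA (mulgA (gn s) (gn s)) gn_idem xE' !xx'.
  have /bop_gn -> : bop B s g' = Some f.
    apply/Pbop; split; last by rewrite -fE rg' -PM ev_cat !mulgA.
    by apply: Or44; rewrite -PM (bop_gn gs).
  have /bop_gn -> : bop B g s = Some f.
    apply/Pbop; split; last by rewrite -fE rg -PM ev_cons ?mulgA.
    by apply: Or43; rewrite -PM (bop_gn sg).
  by split=> //; exact: bop_gn.
have [e re] := relP [::] w erefl.
have rel_inj a b g g' : rel a b g -> rel a b g' -> g = g'.
  by rewrite /rel => h1 h2; apply: Pinj; rewrite /= h1 h2.
have re' : rel w [::] e.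
  by move: re; rewrite /rel ev_nil mulg1 mul1g xx.
have pre a b g : w = a ++ b -> rel a b g ->
    gn e * ev a = ev a * gn g /\ rc (gn e) (ev a).
  elim/last_ind: a b g => [|a s IH] b g wE rg.
    rewrite -(wE : w = b) in rg.
    rewrite ev_nil mul1g mulg1 (rel_inj _ _ _ _ rg re).
    by split=> //; apply: rc1.
  rewrite -cats1 -catA in wE rg; have [g' rg'] := relP _ _ wE.
  have [h1 h2 h3] := step _ _ _ _ _ wE rg' rg.
  have [IH1 IH2] := IH _ _ wE rg'.
  rewrite -cats1 ev_cat mulgA IH1 -!mulgA; split; first by rewrite h1.
  apply: rcM => //; rewrite IH1; exists (gn g').
  by rewrite -!mulgA h2 gn_idem.
(* In particular [e x q = e]. *)
have [_ [q eq]] := pre w [::] e (esym (cats0 w)) re'.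
have suf a b g : w = a ++ b -> rel a b g -> gn g * ev b = ev b * gn e.
  elim: b a g => [|s b IH] a g wE rg.
    rewrite cats0 in wE; rewrite -wE in rg; rewrite ev_nil mul1g mulg1.
    by rewrite (rel_inj _ _ _ _ rg re').
  have wE' : w = (a ++ [:: s]) ++ b by rewrite -catA.
  have [g' rg'] := relP _ _ wE'.
  have [h1 h2 h3] := step _ _ _ _ _ wE rg rg'.
  by rewrite ev_cons mulgA h1 -!mulgA (IH _ _ wE' rg').
have [a [s [b [wE hs]]]] := long_block w0 xx.
have xE : x = ev a * gn s * ev b by rewrite -mulgA -ev_cons -ev_cat -wE.
have sE : gn s * ev b * x * ev a * gn s = gn s.
  have xE' z : ev a * (gn s * (ev b * z)) = x * z by rewrite xE -!mulgA.
  have xx' z : x * (x * z) = x * z by rewrite mulgA xx.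
  case: hs => [[r hr]|[r hr]].
    have {2}<- : gn s * (ev b * (x * r)) = gn s by rewrite -[RHS]hr !mulgA.
    by rewrite -!mulgA xE' !xx' -[RHS]hr !mulgA.
  have hr' : r * (x * (ev a * gn s)) = gn s by rewrite -[RHS]hr !mulgA.
  have {1}<- := hr'; rewrite -[RHS]hr' -!mulgA xE' !xx'; congr (_ * _).
have [g rg] := relP _ _ wE.
have wE' : w = (a ++ [:: s]) ++ b by rewrite -catA.
have [g' rg'] := relP _ _ wE'.
have [h1 h2 h3] := step _ _ _ _ _ wE rg rg'.
have gs : gn g * gn s = gn s.
  have : bop B g s = Some s.
    apply/Pbop.
    have h : Phi (gn g) * Phi (gn s) = Phi (gn s).
      by rewrite rg -PM -[in RHS]sE ev_cons ?mulgA.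
    by split=> //; apply: Or42.
  exact: bop_gn.
have ex : x = gn e * x.
  by rewrite xE -{1}gs !mulgA -(pre _ _ _ wE rg).1.
have xe : x = x * gn e.
  by rewrite xE -{1}gs h1 -!mulgA (suf _ _ _ wE' rg').
exists e; rewrite {1}xe; move: eq; rewrite mulgA -ex => <-.
by rewrite mulgA xx.
Qed.

End Easdown.

(** * Irreducible factorisations *)

Section Irreducible.
Variables (E : finType) (B : biordered E).
Local Notation M := (IG1 B).
Local Notation gn := (gn B).
Local Notation ev := (ev B).
Local Notation seeded := (seeded B).
Implicit Types u v w a b c d : seq E.
Implicit Types us vs : seq (seq E).
Implicit Types (x y z r : M) (xs ys l p : seq M).

(** If [x = x y x] then [x y] is a generator [e] and [x = e x], so [e] is a
    seed of the word [e w]; having a seed depends on the element only. *)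
Lemma regular_seeded w : w <> [::] -> regular (ev w) -> seeded w.
Proof.
move=> w0 [y xyx].
have [||e wE] := @ig1_idem _ B (w ++ repr y).
- by case: (w) w0.
- by rewrite ev_cat evK mulgA xyx.
rewrite ev_cat evK in wE.
have /seeded_ev h : ev (e :: w) = ev w by rewrite ev_cons -wE xyx.
apply/h; exists [::], e, w; split=> //; split; first exact: lc1.
by exists y; rewrite wE gn_idem.
Qed.

Lemma mul_eq1 x y : x * y = 1 -> x = 1 /\ y = 1.
Proof.
rewrite -(evK x) -(evK y) -ev_cat => /ev_eq1.
by case: (repr x) => [|? ?] //= ->.
Qed.

(** Irreducible sequences as lists of elements of the monoid, the identity
    being excluded. *)
Definition irred xs :=
  (forall x, x \in xs -> x <> 1 /\ regular x) /\
  (forall p l s, xs = p ++ l ++ s -> (1 < size l)%N -> ~ regular (\prod_(x <- l) x)).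

Lemma irred_cat xs ys : irred (xs ++ ys) -> irred xs /\ irred ys.
Proof.
move=> [h1 h2]; split; split.
- by move=> x hx; apply: h1; rewrite mem_cat hx.
- by move=> p l s E1; apply: (h2 p l (s ++ ys)); rewrite E1 -!catA.
- by move=> x hx; apply: h1; rewrite mem_cat hx orbT.
- by move=> p l s E1; apply: (h2 (xs ++ p) l s); rewrite E1 -!catA.
Qed.
Lemma irred_cons x xs : irred (x :: xs) -> irred xs.
Proof. by rewrite -cat1s => /irred_cat[]. Qed.

(** A consecutive product meets a pair of neighbours in both, in none, in the
    left one as its last factor, or in the right one as its first factor; [ha]
    and [hb] take care of the last two cases. *)
Lemma irred_change l1 l2 (a b a' b' : M) : a * b = a' * b' ->
  (forall y, regular (y * a') -> regular (y * a)) ->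
  (forall y, regular (b' * y) -> regular (b * y)) ->
  regular a' -> regular b' -> a' <> 1 -> b' <> 1 ->
  irred (l1 ++ [:: a; b] ++ l2) -> irred (l1 ++ [:: a'; b'] ++ l2).
Proof.
move=> ab ha hb ra rb a1 b1 [h1 h2]; split.
  move=> x; rewrite mem_cat !inE => /or4P[hx|/eqP->|/eqP->|hx] //.
    by apply: h1; rewrite mem_cat hx.
  by apply: h1; rewrite mem_cat !inE hx !orbT.
move=> p l s E1 l_gt1 rl.
have [[c [pE lE]]|[c [l1E lE]]] := cat_split E1.
- case: c pE lE => [|x [|y c]] pE.
  + case: l l_gt1 rl {E1} => [|? [|? l]] //= _ rl [? ? l2E]; subst.
    apply: (h2 l1 [:: a, b & l] s) => //.
    by move: rl; rewrite !big_cons !mulgA ab.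
  + case=> ?; subst x; case: l l_gt1 rl {E1} => [|? l] //= l_gt1 rl [? l2E]; subst.
    apply: (h2 (l1 ++ [:: a]) (b :: l) s) => //; first by rewrite -catA.
    by rewrite big_cons; apply: hb; rewrite big_cons in rl.
  + move=> [? ? l2E]; subst.
    by apply: (h2 (l1 ++ [:: a, b & c]) l s) => //; rewrite -!catA.
- have [[d [cE dE]]|[d [lE2 dE]]] := cat_split lE; last first.
    case: d lE2 dE => [|x [|y d]] /= lE2.
    + move=> _; apply: (h2 p l ([:: a; b] ++ l2)) => //.
      by rewrite l1E lE2 cats0 -!catA.
    + case=> ? sE; subst x.
      apply: (h2 p (c ++ [:: a]) (b :: l2)) => //.
      * by rewrite l1E -!catA.
      * by move: l_gt1; rewrite lE2 !size_cat.
      * by move: rl; rewrite lE2 !big_cat /= !big_seq1 => /ha.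
    + case=> ? ? l2E; subst x y.
      apply: (h2 p (c ++ [:: a, b & d]) s) => //.
      * by rewrite l1E l2E -!catA.
      * by move: l_gt1; rewrite lE2 !size_cat.
      * by move: rl; rewrite lE2 !big_cat /= !big_cons !mulgA -(mulgA _ a) ab mulgA.
  apply: (h2 p l (d ++ [:: a; b] ++ l2)) => //.
  by rewrite l1E cE -!catA.
Qed.

(** The element version of [word_shift]. *)
Definition shift xs ys := exists l1 r z r' l2,
  [/\ xs = l1 ++ [:: r * z; r'] ++ l2, ys = l1 ++ [:: r; z * r'] ++ l2,
      rc r z & lc z r'].

(** The equivalence generated by shifts, built by adding steps at the front. *)
Inductive shifts : seq M -> seq M -> Prop :=
| shifts_refl xs : shifts xs xs
| shifts_step xs ys zs : shift xs ys \/ shift ys xs -> shifts ys zs -> shifts xs zs.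

Lemma shifts_trans xs ys zs : shifts xs ys -> shifts ys zs -> shifts xs zs.
Proof. by elim=> // ? ? ? h _ IH /IH; apply: shifts_step. Qed.
Lemma shifts_mv xs ys : shift xs ys -> shifts xs ys.
Proof. by move=> h; apply: shifts_step (shifts_refl _); left. Qed.
Lemma shifts_mvV xs ys : shift ys xs -> shifts xs ys.
Proof. by move=> h; apply: shifts_step (shifts_refl _); right. Qed.
Lemma shifts_sym xs ys : shifts xs ys -> shifts ys xs.
Proof.
elim=> [?|? ? ? h _ IH]; first exact: shifts_refl.
by apply: shifts_trans IH _; case: h; [apply: shifts_mvV|apply: shifts_mv].
Qed.
Lemma shifts_cons x xs ys : shifts xs ys -> shifts (x :: xs) (x :: ys).
Proof.
elim=> [?|? ? ? h _]; first exact: shifts_refl.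
apply: shifts_step; case: h => -[l1 [r [z [r' [l2 [-> -> h1 h2]]]]]]; [left|right];
  by exists (x :: l1), r, z, r', l2.
Qed.

Lemma irred_shift xs ys : shift xs ys -> irred xs <-> irred ys.
Proof.
move=> [l1 [r [z [r' [l2 [-> -> h1 h2]]]]]].
split=> h; have [hl _] := h.
- have [z1 rz] : r * z <> 1 /\ regular (r * z) by apply: hl; rewrite mem_cat !inE eqxx orbT.
  have [r1 rr] : r' <> 1 /\ regular r' by apply: hl; rewrite mem_cat !inE eqxx !orbT.
  apply: irred_change h; rewrite ?mulgA //.
  + by move=> y ry; rewrite mulgA; apply: regular_rc => //; apply: rc_mul.
  + move=> y; rewrite -mulgA; apply: regular_lcV; exact: lc_mul.
  + exact: regular_rcV rz.
  + exact: regular_lc.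
  + move=> r1'; case: h1 => q; rewrite r1' mul1g => /mul_eq1 [z1' _].
    by apply: z1; rewrite r1' z1' mulg1.
  + by move=> /mul_eq1[].
- have [z1 rz] : z * r' <> 1 /\ regular (z * r') by apply: hl; rewrite mem_cat !inE eqxx !orbT.
  have [r1 rr] : r <> 1 /\ regular r by apply: hl; rewrite mem_cat !inE eqxx !orbT.
  apply: irred_change h; rewrite ?mulgA //.
  + by move=> y; rewrite mulgA; apply: regular_rcV; apply: rc_mul.
  + move=> y ry; rewrite -mulgA; apply: regular_lc => //; exact: lc_mul.
  + exact: regular_rc.
  + exact: regular_lcV rz.
  + by move=> /mul_eq1[].
  + move=> r1'; case: h2 => q; rewrite r1' mulg1 => /mul_eq1 [_ z1'].
    by apply: z1; rewrite r1' z1' mulg1.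
Qed.

Lemma irred_shifts xs ys : shifts xs ys -> irred xs -> irred ys.
Proof.
elim=> // {}xs {}ys zs h _ IH hx; apply: IH.
by case: h => /irred_shift [h1 h2]; auto.
Qed.

Lemma ev_flatten us : ev (flatten us) = \prod_(x <- map ev us) x.
Proof. by elim: us => [|u us IH] /=; rewrite ?big_nil // ev_cat big_cons IH. Qed.

Lemma irred_all_seeded us : irred (map ev us) -> all_seeded B us.
Proof.
move=> [h _] u u_us; have [u1 ru] := h _ (map_f ev u_us).
by apply: regular_seeded => // u0; apply: u1; rewrite u0.
Qed.

Lemma irred_not us1 us us2 : irred (map ev (us1 ++ us ++ us2)) -> (1 < size us)%N ->
  ~ regular (ev (flatten us)).
Proof.
move=> [_ h] us_gt1; rewrite ev_flatten; apply: (h (map ev us1) _ (map ev us2)).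
  by rewrite !map_cat.
by rewrite size_map.
Qed.

(** Here [t L y x k t] and [x R x k t]; so [x] and [t] lie in one D-class, and
    the factor that recovers [t] also recovers [x] from [y x]. *)
Lemma lc_pull x y k (t : M) : lc (y * (x * k)) t -> rc x (k * t) -> lc y x.
Proof.
move=> [p h1] [q h2]; exists (x * k * p).
rewrite !mulgA in h1.
have h3 : t * q = p * (y * x).
  by rewrite -[in LHS]h1 -[in RHS]h2 !mulgA.
by rewrite -!mulgA -h3 -[RHS]h2 !mulgA.
Qed.

(** Suppose that a prefix [p z] of [p] followed by seeded blocks is absorbed
    by the letter [t] following it. Then the block that contains [t] absorbs
    everything before it: its seed is D-related to [t], on either side of it.
    In an irreducible splitting this is impossible when [p] is the block in
    front. *)
Lemma cutoff us (p : M) (z : seq E) (t : E) b : all_seeded B us -> flatten us = z ++ t :: b ->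
  lc (p * ev z) (gn t) ->
  exists us1 u us2, us = us1 ++ u :: us2 /\ regular (p * ev (flatten (us1 ++ [:: u]))).
Proof.
move=> sd /flatten_locate[us1 [u1 [u2 [us2 [usE zE bE]]]]] h.
exists us1, (u1 ++ t :: u2), us2; split=> //.
have [c [s [d [uE [sd1 sd2]]]]] : seeded (u1 ++ t :: u2).
  by apply: sd; rewrite usE mem_cat inE eqxx orbT.
rewrite flatten_cat /= cats0 ev_cat uE ev_cat ev_cons.
set P := p * ev (flatten us1).
have {}h : lc (P * ev u1) (gn t) by rewrite /P -mulgA -ev_cat -zE.
suff hs : lc (P * ev c) (gn s).
  rewrite mulgA -/P !mulgA; apply: regular_rc; first exact: rc_mul.
  by apply: regular_lc => //; exists (gn s); rewrite !gn_idem.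
have [[[|x k] [cE kE]]|[[|x k] [u1E kE]]] := cat_split uE.
- case: kE => ? _; subst s; by rewrite cE cats0.
- case: kE => ? _; subst x.
  rewrite cE ev_cat mulgA; apply: lcM.
    by move: sd1; rewrite cE ev_cat => /lcMr.
  by rewrite ev_cons -[X in lc _ X]mulgA; apply: lc_mul.
- case: kE => ? _; subst s; by rewrite -[c]cats0 -u1E.
- case: kE => ? dE; subst x.
  apply: (@lc_pull _ _ (ev k) (gn t)).
    by rewrite -mulgA -ev_cons -(ev_cat _ c) -u1E.
  by move: sd2; rewrite dE ev_cat ev_cons mulgA => /rcMl.
Qed.

Lemma irred_nonnil us : irred (map ev us) -> flatten us = [::] -> us = [::].
Proof.
case: us => // u us /irred_all_seeded h /=.
have : seeded u by apply: h; rewrite inE eqxx.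
by case: u {h} => // /seeded_nil.
Qed.

(** Say that the first blocks are [u] and [u z]. By [cutoff] the seed of [u z]
    lies in [u], for otherwise [u] and some of the blocks after it would have
    a regular product; so [u z R u]. The seed of the block after [u] does not
    lie in [z], because then the product of [u] and that block would be
    regular; and it lies in the block [v] after [u z], by [cutoff] again. So
    [z v L v], the part [z] can be shifted to [v], and the first blocks can be
    removed. *)
Lemma same_word n us vs : (size us + size vs <= n)%N ->
  irred (map ev us) -> irred (map ev vs) -> flatten us = flatten vs ->
  shifts (map ev us) (map ev vs).
Proof.
elim: n us vs => [|n IH] us vs.
  by case: us vs => [|//] [|//] _ _ _ _; apply: shifts_refl.
wlog : us vs / exists u (z : seq E) us' vs', us = u :: us' /\ vs = (u ++ z) :: vs'.
  move=> wl sz iu iv fl.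
  case: us vs fl sz iu iv => [|u us] [|v vs] fl sz iu iv.
  - exact: shifts_refl.
  - by have := irred_nonnil iv (esym fl).
  - by have := irred_nonnil iu fl.
  - have [[z [vE _]]|[z [uE _]]] := cat_split fl.
      by apply: wl => //; exists u, z, us, vs; rewrite vE.
    apply: shifts_sym; apply: wl => //; last by rewrite addnC.
    by exists v, z, vs, us; rewrite uE.
move=> [u [z [us' [vs' [-> ->]]]]] {us vs} /= sz iu iv.
rewrite -catA => /eqP; rewrite eqseq_cat // eqxx => /eqP fl.
have [sdu sdu'] := (all_seeded_cons _ _ _).1 (irred_all_seeded (us := u :: us') iu).
have [sdv sdv'] := (all_seeded_cons _ _ _).1
  (irred_all_seeded (us := (u ++ z) :: vs') iv).
have iu' := irred_cons iu.
case: vs' sz iv fl sdv' => [|v vs] sz iv fl sdv'.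
  case: us' fl iu {sz sdu' iu'} => [|u' us'] fl iu.
    by move: fl => /=; rewrite cats0 => <-; rewrite cats0; apply: shifts_refl.
  have /= [] := @irred_not [::] (u :: u' :: us') [::]; rewrite ?cats0 //.
  by rewrite cats0 in fl; rewrite -[u' ++ _]/(flatten (u' :: us')) fl; apply: seeded_regular.
have [sdv2 sdvs] := (all_seeded_cons _ _ _).1 sdv'.
have rcz : rc (ev u) (ev z).
  (* [t] is the seed of the block [u ++ z]. *)
  have [a [t [b [vE [h1 h2]]]]] := sdv.
  have [[k [aE zE]]|[[|x k] [uE zE]]] := cat_split vE.
  - have [||us1 [w [us2 [usE]]]] := @cutoff us' (ev u) k t (b ++ flatten (v :: vs)) sdu'.
      by rewrite fl zE -catA.
      by rewrite -ev_cat -aE.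
    rewrite -ev_cat; case/(@irred_not [::] (u :: us1 ++ [:: w]) us2).
      by rewrite /= -catA -usE.
    by rewrite /= size_cat addn1.
  - rewrite cats0 in uE; subst a.
    have [||us1 [w [us2 [usE]]]] := @cutoff us' (ev u) [::] t (b ++ flatten (v :: vs)) sdu'.
      by rewrite fl -[z]/([::] ++ z) -zE.
      by rewrite ev_nil mulg1.
    rewrite -ev_cat; case/(@irred_not [::] (u :: us1 ++ [:: w]) us2).
      by rewrite /= -catA -usE.
    by rewrite /= size_cat addn1.
  - case: zE => ? bE; subst x; rewrite uE ev_cat ev_cons; apply: rc_mul.
    by apply: rcMr; rewrite -ev_cat -bE.
case: us' fl sz iu iu' sdu' => [|u' us'] fl sz iu iu' sdu'.
  case: v sdv2 fl {sz iv sdv'} => [/seeded_nil//|x v] _.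
  by case: (z).
have [sdu2 sdus] := (all_seeded_cons _ _ _).1 sdu'.
have lcz : lc (ev z) (ev v).
  (* [s] is the seed of the block [u'] after [u]. *)
  have [c [s [d [u'E [h1 h2]]]]] := sdu2.
  have : (z ++ v ++ flatten vs) = c ++ s :: d ++ flatten us'.
    by move: fl => /= <-; rewrite u'E -catA.
  move=> /cat_split [[k [cE kE]]|[[|x k] [zE kE]]]; last 2 first.
  - rewrite cats0 in zE; subst c.
    case: v sdv2 kE {sz iv sdv' fl} => [/seeded_nil//|x v] _ [? _]; subst x.
    by rewrite ev_cons; apply: lc_mul.
  - case: kE => ? kE; subst x.
    have [] := @irred_not [::] [:: u; u'] us' iu isT.
    rewrite /= cats0 ev_cat u'E ev_cat ev_cons !mulgA.
    apply: regular_rc; first exact: rc_mul.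
    rewrite -mulgA; apply: regular_rc; last exact: seeded_regular.
    by move: rcz; rewrite zE ev_cat ev_cons mulgA => /rcMl.
  move: h1; rewrite cE ev_cat => h1.
  have [[m [kE2 mE]]|[[|x m] [vE mE]]] := cat_split kE.
  - have [|us1 [w [us2 [usE]]]] := @cutoff vs (ev v) m s (d ++ flatten us') sdvs mE.
      by rewrite -ev_cat -kE2; apply: lcMr h1.
    rewrite -ev_cat; case/(@irred_not [:: u ++ z] (v :: us1 ++ [:: w]) us2).
      by rewrite /= -catA -usE.
    by rewrite /= size_cat addn1.
  - rewrite cats0 in vE; subst k.
    have [|us1 [w [us2 [usE]]]] := @cutoff vs (ev v) [::] s (d ++ flatten us') sdvs (esym mE).
      by rewrite ev_nil mulg1; apply: lcMr h1.
    rewrite -ev_cat; case/(@irred_not [:: u ++ z] (v :: us1 ++ [:: w]) us2).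
      by rewrite /= -catA -usE.
    by rewrite /= size_cat addn1.
  - case: mE => ? _; subst x; rewrite vE ev_cat ev_cons mulgA; apply: lc_mul.
    exact: lcMl.
have mvv : shift (map ev ((u ++ z) :: v :: vs)) (map ev (u :: (z ++ v) :: vs)).
  exists [::], (ev u), (ev z), (ev v), (map ev vs); split=> //=; by rewrite ev_cat.
apply: (@shifts_trans _ (map ev (u :: (z ++ v) :: vs))); last exact: shifts_mvV.
apply: shifts_cons; apply: (IH (u' :: us') ((z ++ v) :: vs)) => //=.
- by move: sz => /=; lia.
- exact: irred_cons ((irred_shift mvv).1 iv).
- by move: fl => /= ->; rewrite catA.
Qed.

(** One application of a relation, in either direction. Merging is excluded by
    irreducibility; a relation inside a block leaves the elements as they are. *)
Lemma word_step u v : ig_eq B u v -> forall us, flatten us = u -> irred (map ev us) ->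
  exists vs, flatten vs = v /\ shifts (map ev us) (map ev vs).
Proof.
pose P u v := forall us, flatten us = u -> irred (map ev us) ->
  exists vs, flatten vs = v /\ shifts (map ev us) (map ev vs).
suff: ig_eq B u v -> P u v /\ P v u by move=> h /h[].
elim=> {u v} [w|u v _ []//|u v w _ [h1 h1'] _ [h2 h2']|u v e f g efg].
- by split=> us fl _; exists us; split=> //; apply: shifts_refl.
- have tr a b c : P a b -> P b c -> P a c.
    move=> ab bc us fl iu; have [vs [fl1 lk1]] := ab _ fl iu.
    have [ws [fl2 lk2]] := bc _ fl1 (irred_shifts lk1 iu).
    by exists ws; split=> //; apply: shifts_trans lk1 lk2.
  by split; [apply: tr h1 h2|apply: tr h2' h1'].
split=> us fl iu.
- have [us1 [u1 [u2 [us2 [h1 uE vE h2]]]]] := pair_locate efg (irred_all_seeded iu) fl.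
  exists (us1 ++ (u1 ++ g :: u2) :: us2); split.
    by rewrite flatten_cat /= uE vE -!catA.
  have -> : map ev (us1 ++ (u1 ++ g :: u2) :: us2) =
      map ev (us1 ++ (u1 ++ e :: f :: u2) :: us2).
    by rewrite !map_cat /= !ev_cat !ev_cons -(bop_gn efg) !mulgA.
  have mvE us' vs' : word_shift B us' vs' -> shift (map ev us') (map ev vs').
    move=> [l1 [r [z [r' [l2 [-> -> ? ?]]]]]].
    exists (map ev l1), (ev r), (ev z), (ev r'), (map ev l2); split=> //;
    by rewrite map_cat /= ev_cat.
  case: h2 => [->|/mvE|/mvE|[x [y [usE xyE]]]].
  + exact: shifts_refl.
  + exact: shifts_mv.
  + exact: shifts_mvV.
  + rewrite usE in iu; have [] := @irred_not us1 [:: x; y] us2 iu isT.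
    rewrite /= cats0 -xyE; apply: seeded_regular; apply: h1.
    by rewrite mem_cat inE eqxx orbT.
- have [us1 [u1 [u2 [us2 [usE uE vE]]]]] := flatten_locate fl.
  exists (us1 ++ (u1 ++ e :: f :: u2) :: us2); split.
    by rewrite flatten_cat /= uE vE -!catA.
  rewrite usE !map_cat /= !ev_cat !ev_cons -(bop_gn efg) !mulgA.
  exact: shifts_refl.
Qed.

Theorem irreducible_linked xs ys : irred xs -> irred ys ->
  \prod_(x <- xs) x = \prod_(y <- ys) y -> shifts xs ys.
Proof.
have mE zs : zs = map ev (map (fun x => repr x) zs).
  by rewrite -map_comp -[LHS]map_id; apply: eq_map => x /=; rewrite evK.
rewrite (mE xs) (mE ys) -!ev_flatten; move: (map _ xs) (map _ ys) => us vs iu iv.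
move=> /evP /word_step /(_ us erefl iu) [ws [fl lk1]].
apply: (shifts_trans lk1); apply: (@same_word _ _ _ (leqnn _)) => //.
exact: irred_shifts lk1 iu.
Qed.

End Irreducible.

(** * The embedding and Green's relations *)

Section Embedding.
Variables (E : finType) (B : biordered E).
Local Notation M := (IG1 B).
Local Notation gn := (gn B).
Local Notation ev := (ev B).
Local Open Scope quotient_scope.

(** The semigroup as the set of nonempty words; all Green relations are
    computed on the other side of this map. *)
Definition emb (x : IG B) : M := ev (igseq (repr x)).

Lemma emb_pi w : emb (\pi_(IG B) w) = ev (igseq w).
Proof.
apply/evP.
have /eqmodP/asboolP : \pi_(IG B) (repr (\pi_(IG B) w)) = \pi_(IG B) w by rewrite reprK.
by [].
Qed.

Lemma emb_inj : injective emb.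
Proof.
move=> x y /evP h; rewrite -(reprK x) -(reprK y); apply/eqmodP/asboolP; exact: h.
Qed.

Lemma emb_mul : {morph emb : x y / x * y}.
Proof. by move=> x y; rewrite [x * y]/(ig_mul x y) /ig_mul emb_pi -ev_cat. Qed.

Lemma emb_gen e : emb (ig_gen B e) = gn e.
Proof. by rewrite emb_pi. Qed.

Lemma emb_neq1 x : emb x <> 1.
Proof. by move/ev_eq1. Qed.

Lemma emb_surj (m : M) : m <> 1 -> exists x, emb x = m.
Proof.
rewrite -(evK m); case: (repr m) => [|e w] h; first by case: h.
by exists (\pi_(IG B) (e, w)); rewrite emb_pi.
Qed.

Lemma leRP (x y : IG B) : leR x y <-> exists z, emb x = emb y * z.
Proof.
split=> [[->|[z ->]]|[z h]].
- by exists 1; rewrite mulg1.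
- by exists (emb z); rewrite emb_mul.
- have [z1|/emb_surj [t tz]] := pselect (z = 1).
    by left; apply: emb_inj; rewrite h z1 mulg1.
  by right; exists t; apply: emb_inj; rewrite emb_mul tz.
Qed.
Lemma leLP (x y : IG B) : leL x y <-> exists z, emb x = z * emb y.
Proof.
split=> [[->|[z ->]]|[z h]].
- by exists 1; rewrite mul1g.
- by exists (emb z); rewrite emb_mul.
- have [z1|/emb_surj [t tz]] := pselect (z = 1).
    by left; apply: emb_inj; rewrite h z1 mul1g.
  by right; exists t; apply: emb_inj; rewrite emb_mul tz.
Qed.

Lemma regular_eltE x : regular_elt x <-> regular (emb x).
Proof.
split=> [[y h]|[y h]]; first by exists (emb y); rewrite -!emb_mul h.
have [y1|/emb_surj [t ty]] := pselect (y = 1); last first.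
  by exists t; apply: emb_inj; rewrite !emb_mul ty.
exists x; apply: emb_inj; rewrite !emb_mul.
by rewrite y1 mulg1 in h; rewrite !h.
Qed.

Lemma greenR_rc x y (z : M) : emb y = emb x * z -> rc (emb x) z -> greenR x y.
Proof.
move=> h [q hq]; split; apply/leRP; last by exists z.
by exists q; rewrite h -mulgA hq.
Qed.
Lemma greenL_lc x y (z : M) : emb y = z * emb x -> lc z (emb x) -> greenL x y.
Proof.
move=> h [q hq]; split; apply/leLP; last by exists z.
by exists q; rewrite h mulgA hq.
Qed.
Lemma greenR_sym (x y : IG B) : greenR x y -> greenR y x. Proof. by case. Qed.
Lemma greenL_sym (x y : IG B) : greenL x y -> greenL y x. Proof. by case. Qed.

Lemma greenR_trans (y x z : IG B) : greenR x y -> greenR y z -> greenR x z.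
Proof.
have tr (a b c : IG B) : leR a b -> leR b c -> leR a c.
  move=> /leRP[p h1] /leRP[q h2]; apply/leRP; exists (q * p).
  by rewrite h1 h2 mulgA.
by move=> [a b] [c d]; split; [apply: tr a c|apply: tr d b].
Qed.

Variable D : set (IG B).
Hypothesis DD : is_Dclass D.

Lemma Dclass_R x y : greenR x y -> D x -> D y.
Proof.
case: DD => x0 -> xy [z [h1 h2]]; exists z; split=> //; exact: greenR_trans xy.
Qed.

(** A D-class is given as a composition of L with R in one order only, so this
    needs that the two relations commute. *)
Lemma Dclass_L x y : greenL x y -> D x -> D y.
Proof.
case: DD => x0 -> [/leLP[b xb] /leLP[a ya]] [z [[h1 h2] [/leRP[t zt] /leRP[s xs]]]].
have [w wE] : exists w, emb w = emb y * t.
  apply: emb_surj => /mul_eq1 [y1 _]; exact: emb_neq1 y1.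
have wE' : emb w = a * emb z by rewrite wE ya -mulgA -zt.
exists w; split; last first.
  by split; apply/leRP; [exists t|exists s; rewrite wE' -mulgA -xs -ya].
split; apply/leLP.
  have /leLP[c cE] := h1; exists (c * b).
  by rewrite -mulgA wE (mulgA b) -xb -zt -cE.
by have /leLP[c cE] := h2; exists (a * c); rewrite wE' cE mulgA.
Qed.

End Embedding.

Section Handles.
Variables (E : finType) (B : biordered E).
Local Notation M := (IG1 B).
Local Notation gn := (gn B).
Implicit Types (r x : M) (e h k : E).

Lemma idem_gn x : x <> 1 -> x * x = x -> exists e, x = gn e.
Proof.
rewrite -(evK x) => x1; apply: ig1_idem => h; apply: x1; by rewrite h.
Qed.

Lemma gn_neq1 e : gn e <> 1. Proof. by move/ev_eq1. Qed.

(** If [e h = h] then [h e] is idempotent, and both products are entries of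
    the table. *)
Lemma act_right e h : gn e * gn h = gn h ->
  bop B e h = Some h /\ exists k, bop B h e = Some k.
Proof.
move=> eh; split; first by apply/bopE; split=> //; apply: Or42.
have [||k kE] := @idem_gn (gn h * gn e).
- by move/mul_eq1 => [/gn_neq1].
- by rewrite -mulgA (mulgA _ _ (gn e)) eh mulgA gn_idem.
by exists k; apply/bopE; split=> //; apply: Or43.
Qed.

Lemma act_left e h : gn h * gn e = gn h ->
  bop B h e = Some h /\ exists k, bop B e h = Some k.
Proof.
move=> he; split; first by apply/bopE; split=> //; apply: Or41.
have [||k kE] := @idem_gn (gn e * gn h).
- by move/mul_eq1 => [/gn_neq1].
- by rewrite -mulgA (mulgA (gn h)) he gn_idem.
by exists k; apply/bopE; split=> //; apply: Or44.
Qed.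

(** The action of [e] on the L-class of [r] can be observed on an idempotent
    of that class: if [r e w = r] and [r y r = r], take [h = e w y r]. *)
Lemma handle_right r e : regular r -> rc r (gn e) ->
  exists h y, [/\ gn e * gn h = gn h, gn h = y * r & r * gn h = r].
Proof.
move=> [y ryr] [w rew].
have [||h hE] := @idem_gn (gn e * w * y * r).
- by rewrite -!mulgA => /mul_eq1 [/gn_neq1].
- have h : r * (gn e * (w * (y * r))) = r.
    by rewrite -[RHS]ryr -{3}rew !mulgA.
  by rewrite -!mulgA h.
exists h, (gn e * w * y); split.
- by rewrite -hE !mulgA gn_idem.
- by [].
- by rewrite -hE !mulgA; rewrite !mulgA in rew; rewrite rew.
Qed.

Lemma handle_left r e : regular r -> lc (gn e) r ->
  exists h y, [/\ gn h * gn e = gn h, gn h = r * y & gn h * r = r].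
Proof.
move=> [y ryr] [w rew].
have hr : r * (y * (w * gn e)) * r = r.
  by rewrite -!mulgA (mulgA w) rew mulgA.
have [||h hE] := @idem_gn (r * (y * (w * gn e))).
- by rewrite !mulgA => /mul_eq1 [_ /gn_neq1].
- by rewrite mulgA hr.
exists h, (y * (w * gn e)); split=> //.
- by rewrite -hE -!mulgA gn_idem.
- by rewrite -hE hr.
Qed.

End Handles.

(** * Walks and their labels *)

Section OneClass.
Variables (E : finType) (B : biordered E) (D : set (IG B)).
Hypothesis DD : is_Dclass D.
Variable C : coordinatisation D.
Local Notation gn := (gn B).
Local Notation crd := (@crd _ _ C).
Local Notation emb := (@emb _ B).
Local Notation mx := (@crd_mx _ _ C).

Lemma crdD t : D (crd t).
Proof. by have [h _ _] := crd_bij C; apply: h. Qed.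

Lemma crd_onto x : D x -> exists t, crd t = x.
Proof. by have [_ _ h] := crd_bij C; move=> /h [t _ <-]; exists t. Qed.

Lemma crd_inj : injective crd.
Proof. by have [_ h _] := crd_bij C; move=> x y; apply: h; rewrite in_setE. Qed.

Lemma crd_mulS i g l j h m p : mx l j = Some p ->
  crd (i, g, l) * crd (j, h, m) = crd (i, g * p * h, m).
Proof. by move=> lj; have := crd_mul (c := C) (i, g, l) (j, h, m); rewrite /= lj. Qed.

Lemma crd_mulD i g l j h m : D (crd (i, g, l) * crd (j, h, m)) ->
  exists p, mx l j = Some p.
Proof.
have := crd_mul (c := C) (i, g, l) (j, h, m); rewrite /=.
by case: (mx l j) => [p|//] _ _; exists p.
Qed.

(** The idempotent [e] has the coordinates [(k, v, l)]; then [v] is the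
    generator [fgen k l] of the group, and [e] its formal name. *)
Definition names e k v l := crd (k, v, l) = ig_gen B e.

(** An idempotent [(k, v, l)] satisfies [v p v = v] for the sandwich entry
    [p]. *)
Lemma names_mx e k v l : names e k v l -> mx l k = Some v^-1.
Proof.
move=> h; have ee : ig_gen B e * ig_gen B e = ig_gen B e.
  by apply: emb_inj; rewrite emb_mul emb_gen gn_idem.
have [|p lk] := @crd_mulD k v l k v l; first by rewrite h ee -h; apply: crdD.
rewrite lk; congr Some; move: ee; rewrite -h (crd_mulS _ _ _ _ lk).
move/crd_inj => [] /(congr1 (fun x => v^-1 * x * v^-1)).
by rewrite !mulgA mulVg mul1g mulgK mul1g.
Qed.

Lemma names_letter e k v l b : names e k v l -> @letter_val _ _ _ C (e, b) (if b then v^-1 else v).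
Proof.
move=> h; exists k, l, v; split=> //=.
- by exists v, l; rewrite h.
- by exists k, v; rewrite h.
- by rewrite /fgen (names_mx h) /= invgK.
Qed.

Lemma letter_names e k v l b g : names e k v l -> @letter_val _ _ _ C (e, b) g ->
  g = if b then v^-1 else v.
Proof.
move=> h [i [l' [f [[g1 [l1 /= e1]] [i1 [g2 /= e2]] fE ->]]]].
move: e1 e2; rewrite -h => /crd_inj [? ? ?] /crd_inj [? ? ?]; subst.
by move: fE; rewrite /fgen (names_mx h) /= invgK => -[->].
Qed.

Lemma gen_mulE e f g : gn e * gn f = gn g -> ig_gen B e * ig_gen B f = ig_gen B g.
Proof. by move=> h; apply: emb_inj; rewrite emb_mul !emb_gen. Qed.

(** From [e q = q] and [q e = p], the generators [p] and [q] are R-related,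
    and acting by [e] on an element of the L-class of [q] is multiplying it by
    [p]. *)
Lemma right_act e p q k v l k' w m : names p k v l -> names q k' w m ->
  gn e * gn q = gn q -> gn q * gn e = gn p ->
  forall i0 g, crd (i0, g * v^-1 * w, m) * ig_gen B e = crd (i0, g, l).
Proof.
move=> hp hq eq qe i0 g.
have kk : k' = k.
  apply: ((@crd_greenR _ _ C (k', w, m) (k, v, l)).1 _); rewrite hp hq.
  apply: (@greenR_rc _ _ _ _ (gn e)); rewrite ?emb_gen //.
  by exists (gn q); rewrite eq gn_idem.
subst k'.
have mk := names_mx hq.
have qE : crd (i0, g * v^-1 * w, m) * ig_gen B q = crd (i0, g * v^-1 * w, m).
  by rewrite -hq (crd_mulS _ _ _ _ mk) -mulgA mulVg mulg1.
rewrite -qE -mulgA (gen_mulE qe) -hp (crd_mulS _ _ _ _ mk).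
by rewrite mulgK mulgVK.
Qed.

(** The dual of [right_act]: here [p] and [q] are L-related, and acting by [e]
    on an element of the R-class of [p] is multiplying it by [q]. *)
Lemma left_act e p q i c l j d l' : names p i c l -> names q j d l' ->
  gn p * gn e = gn p -> gn e * gn p = gn q ->
  forall h m, ig_gen B e * crd (i, h, m) = crd (j, d * c^-1 * h, m).
Proof.
move=> hp hq pe ep h m.
have ll : l' = l.
  apply: ((@crd_greenL _ _ C (j, d, l') (i, c, l)).1 _); rewrite hp hq.
  apply: greenL_sym; apply: (@greenL_lc _ _ _ _ (gn e)); rewrite ?emb_gen //.
  by exists (gn p); rewrite pe gn_idem.
subst l'.
have mk := names_mx hp.
have qE : ig_gen B p * crd (i, h, m) = crd (i, h, m).
  by rewrite -hp (crd_mulS _ _ _ _ mk) mulgV mul1g.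
by rewrite -[in LHS]qE mulgA (gen_mulE ep) -hq (crd_mulS _ _ _ _ mk).
Qed.

End OneClass.
Arguments names {E B D} C e k v l.

Section TwoClasses.
Variables (E : finType) (B : biordered E) (D1 D2 : set (IG B)).
Hypotheses (DD1 : is_Dclass D1) (DD2 : is_Dclass D2).
Variables (C1 : coordinatisation D1) (C2 : coordinatisation D2).
Local Notation gn := (gn B).
Local Notation ev := (ev B).
Local Notation emb := (@emb _ B).
Local Notation G := (crd_grp C1 * dual_group (crd_grp C2))%type.
Local Notation st := (crd_L C1 * crd_I C2)%type.
Implicit Types (p q : E * E) (s : st) (x y : G).

(** The pairs name states, an L-class of the first D-class and an R-class of
    the second: [e] takes the L-class of [q.1] back to that of [p.1], and the
    R-class of [p.2] forward to that of [q.2]. This is the passage of [e] from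
    the left element to the right one. *)
Definition medge p q := [exists e, [&& bop B e q.1 == Some q.1, bop B q.1 e == Some p.1,
  bop B p.2 e == Some p.2 & bop B e p.2 == Some q.2]].
Definition edge p q := medge p q || medge q p.

Definition at_state p s := Lcls s.1 (ig_gen B p.1) /\ Rcls s.2 (ig_gen B p.2).

(** The label of an edge; the factor in the dual group is [d * c] when
    computed in the group itself. *)
Definition lab p q x :=
  [/\ exists a b, [/\ @letter_val _ _ _ C1 (p.1, true) a,
        @letter_val _ _ _ C1 (q.1, false) b & x.1 = a * b] &
      exists c d, [/\ @letter_val _ _ _ C2 (p.2, true) c, @letter_val _ _ _ C2 (q.2, false) d &
        x.2 = (c : dual_group _) * (d : dual_group _)] ].

Inductive walk : nat -> st -> G -> st -> Prop :=
| walk0 s : walk 0 s 1 s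
| walkS n s x s' p q y s'' : walk n s x s' -> edge p q -> at_state p s' ->
    at_state q s'' -> lab p q y -> walk n.+1 s (x * y) s''.

(** The semantics of a label: what happens to the group coordinates when the
    state is changed and the product stays the same. *)
Definition acts s x s' := forall i0 g h nu,
  @crd _ _ C1 (i0, g, s.1) * @crd _ _ C2 (s.2, h, nu) =
  @crd _ _ C1 (i0, g * x.1, s'.1) * @crd _ _ C2 (s'.2, (x.2 : crd_grp C2) * h, nu).

Lemma lab_names p q x k v l k' w m i c n j d o :
  names C1 p.1 k v l -> names C1 q.1 k' w m -> names C2 p.2 i c n -> names C2 q.2 j d o ->
  lab p q x <-> x = (v^-1 * w, ((d * c^-1 : crd_grp C2) : dual_group _)).
Proof.
move=> h1 h2 h3 h4; split; last first.
  move=> ->; split.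
    exists v^-1, w; split=> //; [exact: names_letter true h1|exact: names_letter false h2].
  exists c^-1, d; split=> //; [exact: names_letter true h3|exact: names_letter false h4].
case: x => x1 x2 [[a [b [/(letter_names h1) -> /(letter_names h2) -> /= ->]]]].
by move=> [a' [b' [/(letter_names h3) -> /(letter_names h4) -> /= ->]]].
Qed.


Lemma at_stateP p s : at_state p s -> exists k v c n,
  names C1 p.1 k v s.1 /\ names C2 p.2 s.2 c n.
Proof. by move=> [[k [v h1]] [c [n h2]]]; exists k, v, c, n; split; rewrite /names. Qed.

Lemma acts_inv s x s' : acts s x s' -> acts s' x^-1 s.
Proof.
move=> h i0 g h0 nu; case: x h => x1 x2 h /=.
have := h i0 (g * x1^-1) ((x2 : crd_grp C2)^-1 * h0) nu; rewrite /= mulgVK.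
by move=> ->; rewrite mulVKg.
Qed.

Lemma acts_mul s x s' y s'' : acts s x s' -> acts s' y s'' -> acts s (x * y) s''.
Proof.
by move=> h1 h2 i0 g h nu; rewrite h1 h2 /= !mulgA; congr (_ * @crd _ _ C2 (_, _, _)).
Qed.

Lemma lab_sym p q y s s' : at_state p s -> at_state q s' -> lab p q y -> lab q p y^-1.
Proof.
move=> /at_stateP[k [v [c [n [h1 h2]]]]] /at_stateP[k' [w [d [o [h3 h4]]]]].
move=> /(lab_names _ h1 h3 h2 h4) ->; apply/(lab_names _ h3 h1 h4 h2).
congr (_, _); first by rewrite invgM invgK.
by rewrite [LHS](_ : _ = (d * c^-1 : crd_grp C2)^-1) // invgM invgK.
Qed.

Lemma medge_acts p q s y s' : medge p q -> at_state p s -> at_state q s' ->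
  lab p q y -> acts s y s'.
Proof.
move=> /existsP[e /and4P[/eqP/bop_gn e1 /eqP/bop_gn e2 /eqP/bop_gn e3 /eqP/bop_gn e4]].
move=> /at_stateP[k [v [c [n [h1 h2]]]]] /at_stateP[k' [w [d [o [h3 h4]]]]].
move=> /(lab_names _ h1 h3 h2 h4) -> i0 g h nu /=.
rewrite -(right_act h1 h3 e1 e2) -mulgA (left_act h2 h4 e3 e4).
by rewrite !mulgA.
Qed.

Lemma walk_acts n s x s' : walk n s x s' -> acts s x s'.
Proof.
elim=> [{}s|{}n {}s {}x {}s' p q y s'' _ IH /orP[] pq ps qs lb].
- by move=> i0 g h nu /=; rewrite mulg1 mul1g.
- by apply: acts_mul IH _; apply: medge_acts pq ps qs lb.
- apply: acts_mul IH _; rewrite -[y]invgK; apply: acts_inv.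
  exact: medge_acts pq qs ps (lab_sym ps qs lb).
Qed.

Lemma walk_cat m n s x s' y s'' :
  walk m s x s' -> walk n s' y s'' -> walk (m + n)%N s (x * y) s''.
Proof.
move=> w1 w2; elim: w2 w1 => [?|{}n {}s' {}y t p q z t' _ IH pq pt qt lb] w1.
  by rewrite addn0 mulg1.
rewrite addnS mulgA; exact: walkS (IH w1) pq pt qt lb.
Qed.

Lemma edge_sym p q : edge p q = edge q p. Proof. exact: orbC. Qed.

Lemma walk1 p q s s' y : edge p q -> at_state p s -> at_state q s' -> lab p q y ->
  walk 1 s y s'.
Proof. by rewrite -{2}[y]mul1g; apply: walkS; apply: walk0. Qed.

(** Passing [e] from right to left is an edge too, with the inverse label. *)
Lemma walk_rev n s x s' : walk n s x s' -> walk n s' x^-1 s.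
Proof.
elim=> [?|{}n {}s {}x {}s' p q y s'' _ IH pq ps qs lb]; first by rewrite invg1; apply: walk0.
rewrite invgM -add1n; apply: walk_cat IH.
by apply: walk1 (lab_sym ps qs lb) => //; rewrite edge_sym.
Qed.

(** Conversely, any passage of one generator between two regular elements that
    remain in their D-classes is an edge; [handle_right] and [handle_left]
    provide the names. *)
Lemma step_letter e (x1 x2 : IG B) i0 g l i h nu :
  D1 x1 -> D2 x2 -> regular_elt x1 -> regular_elt x2 ->
  rc (emb x1) (gn e) -> lc (gn e) (emb x2) ->
  x1 * ig_gen B e = @crd _ _ C1 (i0, g, l) -> x2 = @crd _ _ C2 (i, h, nu) ->
  exists a b m j, [/\ walk 1 (l, i) (a, b) (m, j), x1 = @crd _ _ C1 (i0, g * a, m) &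
    ig_gen B e * x2 = @crd _ _ C2 (j, (b : crd_grp C2) * h, nu)].
Proof.
move=> d1 d2 /regular_eltE r1 /regular_eltE r2 h1 h2 x1E x2E.
have [q1 [y1 [eq1 q1E xq1]]] := handle_right r1 h1.
have [p2 [y2 [p2e p2E px2]]] := handle_left r2 h2.
have [bq1 [p1 bp1]] := act_right eq1.
have [bp2 [q2 bq2]] := act_left p2e.
have [[[i1 g1] m] x1E'] := crd_onto C1 d1.
have x1L : greenL x1 (ig_gen B q1).
  by apply: (@greenL_lc _ _ _ _ y1); rewrite ?emb_gen //; exists (emb x1);
    rewrite -mulgA -q1E xq1.
have x2R : greenR x2 (ig_gen B p2).
  by apply: (@greenR_rc _ _ _ _ y2); rewrite ?emb_gen //; exists (emb x2);
    rewrite mulgA -p2E px2.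
have dq1 := Dclass_L DD1 x1L d1.
have dp2 := Dclass_R DD2 x2R d2.
have qpR : greenR (ig_gen B q1) (ig_gen B p1).
  apply: (@greenR_rc _ _ _ _ (gn e)); rewrite ?emb_gen ?(bop_gn bp1) //.
  by exists (gn q1); rewrite eq1 gn_idem.
have pqL : greenL (ig_gen B p2) (ig_gen B q2).
  apply: (@greenL_lc _ _ _ _ (gn e)); rewrite ?emb_gen ?(bop_gn bq2) //.
  by exists (gn p2); rewrite p2e gn_idem.
have [[[k w] m'] nq1] := crd_onto C1 dq1.
have [[[k' v] l'] np1] := crd_onto C1 (Dclass_R DD1 qpR dq1).
have [[[i' c] n] np2] := crd_onto C2 dp2.
have [[[j d] o] nq2] := crd_onto C2 (Dclass_L DD2 pqL dp2).
have ? : m = m'.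
  by apply: ((@crd_greenL _ _ C1 (i1, g1, m) (k, w, m')).1 _); rewrite x1E' nq1.
have ? : i = i'.
  by apply: ((@crd_greenR _ _ C2 (i, h, nu) (i', c, n)).1 _); rewrite -x2E np2.
have ? : i1 = i0.
  apply: ((@crd_greenR _ _ C1 (i1, g1, m) (i0, g, l)).1 _); rewrite x1E' -x1E.
  by apply: (@greenR_rc _ _ _ _ (gn e)) => //; rewrite emb_mul emb_gen.
subst m' i' i1.
have ? : l = l'.
  apply: ((@crd_greenL _ _ C1 (i0, g, l) (k', v, l')).1 _); rewrite np1 -x1E.
  apply: (@greenL_lc _ _ _ _ y1).
    by rewrite emb_mul !emb_gen -(bop_gn bp1) q1E mulgA.
  exists (emb x1); rewrite emb_mul emb_gen -mulgA (mulgA y1) -q1E.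
  by rewrite mulgA xq1.
subst l'.
have m1 : medge (p1, p2) (q1, q2).
  by apply/existsP; exists e; rewrite /= bq1 bp1 bp2 bq2 !eqxx.
have sp : at_state (p1, p2) (l, i).
  by split; [exists k', v|exists c, n].
have sq : at_state (q1, q2) (m, j).
  by split; [exists k, w|exists d, o].
have ac1 := right_act np1 nq1 eq1 (bop_gn bp1) i0.
have ac2 := left_act np2 nq2 p2e (bop_gn bq2) h nu.
exists (v^-1 * w), (d * c^-1 : crd_grp C2), m, j; split.
- apply: walk1 sp sq _; first by rewrite /edge m1.
  by apply/(@lab_names (p1, p2) (q1, q2) _ _ _ _ _ _ _ _ _ _ _ _ _ np1 nq1 np2 nq2).
- have := ac1 (g1 * w^-1 * v); rewrite mulgK mulgVK x1E' x1E => /crd_inj [->].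
  by rewrite -x1E' !mulgA mulgK mulgVK.
- by rewrite x2E.
Qed.

(** The letters of [z] cross one at a time, the last letter first; the
    intermediate elements stay in their D-classes because they lie between
    R-related, respectively L-related, elements. *)
Lemma step_word z (x1 x2 : IG B) i0 g l i h nu :
  D1 x1 -> D2 x2 -> regular_elt x1 -> regular_elt x2 ->
  rc (emb x1) (ev z) -> lc (ev z) (emb x2) ->
  emb x1 * ev z = emb (@crd _ _ C1 (i0, g, l)) -> x2 = @crd _ _ C2 (i, h, nu) ->
  exists n a b m j, [/\ walk n (l, i) (a, b) (m, j), x1 = @crd _ _ C1 (i0, g * a, m) &
    ev z * emb x2 = emb (@crd _ _ C2 (j, (b : crd_grp C2) * h, nu))].
Proof.
elim: z x1 g l => [|e z IH] x1 g l d1 d2 r1 r2 h1 h2 x1E x2E.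
  exists 0, 1, 1, l, i; split; first exact: walk0.
    by apply: emb_inj; rewrite mulg1 -x1E ev_nil mulg1.
  by rewrite ev_nil mul1g x2E mul1g.
rewrite ev_cons in h1 h2 x1E.
pose y1 := x1 * ig_gen B e.
have y1E : emb y1 = emb x1 * gn e by rewrite emb_mul emb_gen.
have rxe := rcMl h1.
have dy1 : D1 y1 by apply: Dclass_R d1 => //; apply: greenR_rc rxe.
have ry1 : regular_elt y1.
  by apply/regular_eltE; rewrite y1E; apply: regular_rc => //; apply/regular_eltE.
have [||n [a [b [m [j [w y1E' zE]]]]]] := IH y1 g l dy1 d2 ry1 r2 _ (lcMr h2) _ x2E.
- by rewrite y1E; apply: rcMr.
- by rewrite y1E -mulgA.
set y2 := @crd _ _ C2 (j, (b : crd_grp C2) * h, nu) in zE.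
have dy2 : D2 y2 by apply: crdD.
have lcy2 : lc (gn e) (emb y2) by rewrite -zE; apply: lcMl.
have ry2 : regular_elt y2.
  by apply/regular_eltE; rewrite -zE; apply: regular_lc; [apply: lcMr h2|apply/regular_eltE].
have [a' [b' [m' [j' [w' x1E' ezE]]]]] := step_letter d1 dy2 r1 ry2 rxe lcy2 y1E' erefl.
exists n.+1, (a * a'), ((b : dual_group _) * b'), m', j'; split.
- by rewrite -addn1; apply: (walk_cat w w').
- by rewrite mulgA.
- rewrite ev_cons -mulgA zE -emb_gen -emb_mul ezE.
  by rewrite mulgA.
Qed.

End TwoClasses.

(** * Products of irreducible sequences *)

Section EnumOrd.

Lemma map_eq_cat (T U : Type) (f : T -> U) s l1 l2 : map f s = l1 ++ l2 ->
  exists s1 s2, [/\ s = s1 ++ s2, l1 = map f s1 & l2 = map f s2].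
Proof.
move=> h; exists (take (size l1) s), (drop (size l1) s); split.
- by rewrite cat_take_drop.
- by rewrite map_take h take_size_cat.
- by rewrite map_drop h drop_size_cat.
Qed.

Lemma enum_pair m e1 (a b : 'I_m.+1) e2 : enum 'I_m.+1 = e1 ++ a :: b :: e2 ->
  exists k : 'I_m, a = before k /\ b = after k.
Proof.
move=> h; have sz : (size e1 + (size e2).+2 = m.+1)%N.
  by rewrite -[RHS]size_enum_ord h size_cat.
have hk : (size e1 < m)%N by lia.
exists (Ordinal hk); split; apply: val_inj => /=.
- have := @nth_enum_ord m.+1 a (size e1); rewrite h nth_cat ltnn subnn /= => -> //; lia.
- have := @nth_enum_ord m.+1 a (size e1).+1; rewrite h nth_cat.
  have -> : ((size e1).+1 < size e1)%N = false by lia.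
  by rewrite subSnn /= => ->; rewrite /bump; lia.
Qed.

(** The factors after the first one in an ordered product. *)
Lemma filter_ord_interval m (i j : 'I_m) e1 e2 e3 : enum 'I_m = e1 ++ (i :: e2) ++ e3 ->
  (j = size e1 + size e2 :> nat)%N ->
  [seq k : 'I_m <- enum 'I_m | (i < k <= j)%N] = e2.
Proof.
move=> h jE; apply: (inj_map val_inj).
rewrite -(filter_map val (fun k => i < k <= j)%N) val_enum_ord.
have hv : iota 0 m = map val e1 ++ val i :: map val e2 ++ map val e3.
  by rewrite -val_enum_ord h map_cat /= map_cat.
have sz : (size e1 + (size e2).+1 + size e3 = m)%N.
  by rewrite -[RHS](size_iota 0) hv size_cat /= size_cat !size_map; lia.
have iE : val i = size e1.
  have := nth_iota 0 0 (i := size e1) (n := m); rewrite hv nth_cat size_map ltnn subnn /=.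
  by rewrite add0n => -> //; lia.
have e2E : map val e2 = iota (size e1).+1 (size e2).
  have : drop (size e1).+1 (iota 0 m) = map val e2 ++ map val e3.
    by rewrite hv drop_cat size_map ltnNge leqnSn /= subSnn /= ?drop0.
  rewrite drop_iota add0n => /(congr1 (take (size e2))).
  rewrite take_size_cat ?size_map // => <-.
  by rewrite take_iota; congr iota; lia.
have -> : iota 0 m = iota 0 ((size e1).+1 + (size e2 + size e3)).
  by congr iota; lia.
rewrite e2E iotaD filter_cat iotaD filter_cat.
have -> : [seq k <- iota 0 (size e1).+1 | (i < k <= j)%N] = [::].
  by apply/eqP; rewrite -(negbK (_ == _)) -has_filter; apply/hasPn => k;
    rewrite mem_iota iE; lia.
have -> : [seq k <- iota (0 + (size e1).+1 + size e2) (size e3) | (i < k <= j)%N] = [::].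
  by apply/eqP; rewrite -(negbK (_ == _)) -has_filter; apply/hasPn => k;
    rewrite mem_iota; lia.
rewrite cats0 add0n /=; apply/all_filterP/allP => k; rewrite mem_iota iE; lia.
Qed.

End EnumOrd.

Section Main.
Variables (E : finType) (B : biordered E) (m : nat).
Local Notation M := (IG1 B).
Local Notation emb := (@emb _ B).

Lemma emb_foldl a (s : seq (IG B)) :
  emb (foldl *%g a s) = emb a * \prod_(x <- s) emb x.
Proof.
elim: s a => [|b s IH] a /=; first by rewrite big_nil mulg1.
by rewrite IH emb_mul big_cons mulgA.
Qed.

Lemma emb_ordprod n (r : 'I_n -> IG B) (i j : 'I_n) e1 e2 e3 :
  enum 'I_n = e1 ++ (i :: e2) ++ e3 -> (j = size e1 + size e2 :> nat)%N ->
  emb (ordprod r i j) = \prod_(k <- i :: e2) emb (r k).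
Proof.
by move=> h jE; rewrite /ordprod (filter_ord_interval h jE) emb_foldl big_map big_cons.
Qed.

Lemma emb_ordprod_all (r : 'I_m.+1 -> IG B) :
  emb (ordprod r ord0 ord_max) = \prod_(k <- enum 'I_m.+1) emb (r k).
Proof.
have h : enum 'I_m.+1 = [::] ++ (ord0 :: map (lift ord0) (enum 'I_m)) ++ [::].
  by rewrite cats0 enum_ordSl.
by rewrite (emb_ordprod _ h) ?h ?cats0 //= size_map size_enum_ord.
Qed.

Lemma irreducible_irred n (r : 'I_n -> IG B) : irreducible_rseq r ->
  irred [seq emb (r k) | k <- enum 'I_n].
Proof.
move=> [h1 h2]; split.
  move=> x /mapP[k _ ->]; split; first exact: emb_neq1.
  exact/regular_eltE.
move=> p l s /map_eq_cat[e1 [e' [eE pE /esym]]].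
move=> /map_eq_cat[[//|i e2] [e3 [e'E -> _]]] //=; subst e'.
rewrite size_map /= => sz.
have nE : (size e1 + ((size e2).+1 + size e3) = n)%N.
  by rewrite -[RHS]size_enum_ord eE !size_cat.
have hj : (size e1 + size e2 < n)%N by lia.
have := h2 i (Ordinal hj); rewrite regular_eltE (emb_ordprod _ eE) // big_cons big_cons big_map.
case: e2 sz hj eE {nE} => //= k e2 _ hj eE; apply.
have := congr1 (nth i ^~ (size e1)) eE; rewrite nth_cat ltnn subnn /= => <-.
by rewrite nth_enum_ord; lia.
Qed.

Variable D : 'I_m.+1 -> set (IG B).
Hypothesis DD : forall k, is_Dclass (D k).
Variable C : forall k, coordinatisation (D k).
Local Notation triples := (forall k, crd_I (C k) * crd_grp (C k) * crd_L (C k))%type.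
Implicit Types x y : triples.

Definition tseq x : seq M := [seq emb (crd (x k)) | k <- enum 'I_m.+1].

(** The labels of walks of any length; that the graph is finite will make the
    set rational. *)
Definition rho (s : 'I_m) (l : crd_L (C (before s))) (i : crd_I (C (after s)))
    (mu : crd_L (C (before s))) (j : crd_I (C (after s))) :
    set (crd_grp (C (before s)) * dual_group (crd_grp (C (after s)))) :=
  [set x | exists n, walk n (l, i) x (mu, j)].

(** The right-hand side of the criterion, for this choice of [rho]. *)
Definition linked x y :=
  [/\ (x ord0).1.1 = (y ord0).1.1, (x ord_max).2 = (y ord_max).2 &
   problemP (fun s => @rho s (x (before s)).2 (x (after s)).1.1
                        (y (before s)).2 (y (after s)).1.1)
               (fun k => (x k).1.2) (fun k => (y k).1.2)].

Lemma linked_refl x : linked x x.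
Proof.
split=> //; exists (fun=> 1); split=> //; first by rewrite mulgV.
move=> s /=; exists 0; rewrite invg1 mulg1 mulVg; exact: walk0.
Qed.

Lemma before_after (s : 'I_m) : before s != after s.
Proof. by rewrite -val_eqE /= /bump; lia. Qed.
Lemma before_inj (s t : 'I_m) : before s = before t -> s = t.
Proof. by move/(congr1 val) => /= h; apply: val_inj. Qed.
Lemma after_inj (s t : 'I_m) : after s = after t -> s = t.
Proof. exact: lift_inj. Qed.

(** A walk at gap [k] multiplies the group coordinate of [y] at position [k] on
    the right and the one at position [k+1] on the left. The equations persist
    if the unknown at position [k+1] receives the same left factor. *)
Lemma linked_step x y y' (k : 'I_m) (a : crd_grp (C (before k)))
    (b : crd_grp (C (after k))) n :
  (forall t, t != before k -> t != after k -> y' t = y t) ->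
  (y' (before k)).1 = ((y (before k)).1.1, (y (before k)).1.2 * a) ->
  (y' (after k)).1.2 = b * (y (after k)).1.2 ->
  (y' (after k)).2 = (y (after k)).2 ->
  walk n ((y (before k)).2, (y (after k)).1.1) (a, (b : dual_group _))
    ((y' (before k)).2, (y' (after k)).1.1) ->
  linked x y -> linked x y'.
Proof.
move=> hy hk1 hk2 hk3 w [h1 h2 [X [X0 Xm XS]]].
have hi t : t != after k -> (y' t).1.1 = (y t).1.1.
  have [->|tb ta] := eqVneq t (before k); first by rewrite hk1.
  by rewrite hy.
have hl t : t != before k -> (y' t).2 = (y t).2.
  have [->|ta tb] := eqVneq t (after k); first by rewrite hk3.
  by rewrite hy.
pose X' : forall t, crd_grp (C t) := dfwith X (b * X (after k)).
have X'k : X' (after k) = b * X (after k) by rewrite /X' dfwith_in.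
have X't t : t != after k -> X' t = X t.
  by move=> ta; rewrite /X' dfwith_out // eq_sym.
have hb t : t != before k -> (X' t)^-1 * (y' t).1.2 = (X t)^-1 * (y t).1.2.
  have [->|ta tb] := eqVneq t (after k); first by rewrite X'k hk2 invgM !mulgA mulgVK.
  by rewrite hy // X't.
split.
- by rewrite h1 hi // neq_lift.
- rewrite h2 hl //; by rewrite -val_eqE /= neq_ltn ltn_ord orbT.
exists X'; split.
- by rewrite X't // neq_lift.
- have := hb ord_max; rewrite Xm => /(_ _) h.
  have {}h : (X' ord_max)^-1 * (y' ord_max).1.2 = (x ord_max).1.2.
    rewrite h; first by rewrite invgM invgK mulgVK.
    by rewrite -val_eqE /= neq_ltn ltn_ord orbT.
  by rewrite -h invgM invgK mulVKg.
move=> s; have [sk|sk] := eqVneq s k.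
  subst s; rewrite X'k hk1 /= X't ?before_after //.
  have [n0 w0] := XS k; exists (n0 + n)%N.
  have := walk_cat w0 w; congr (walk _ _ _ _); congr (_, _).
  by rewrite mulgA.
have sb : before s != before k by apply: contra sk => /eqP/before_inj ->.
have sa : after s != after k by apply: contra sk => /eqP/after_inj ->.
rewrite -mulgA hb // hl // hi // X't // mulgA; exact: XS.
Qed.

Lemma tseq_pair y l1 (p q : M) l2 : tseq y = l1 ++ [:: p; q] ++ l2 ->
  exists k : 'I_m, [/\ p = emb (crd (y (before k))), q = emb (crd (y (after k))) &
   forall y', (forall t, t != before k -> t != after k -> y' t = y t) ->
     tseq y' = l1 ++ [:: emb (crd (y' (before k))); emb (crd (y' (after k)))] ++ l2].
Proof.
move=> /map_eq_cat[e1 [[|a [|b e2]] [eE -> //]]] [-> -> ->].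
have [k [aE bE]] := enum_pair eE; subst a b; exists k; split=> // y' hy.
rewrite /tseq eE map_cat /=.
have := enum_uniq 'I_m.+1; rewrite eE cat_uniq /= inE !negb_or.
case/and5P=> _ /and3P[b1 a1 _] /andP[_ b2] a2 _.
have hE e : (forall t, t \in e -> t != before k /\ t != after k) ->
    [seq emb (crd (y' t)) | t <- e] = [seq emb (crd (y t)) | t <- e].
  by move=> h; apply/eq_in_map => t /h [h1 h2]; rewrite hy.
by rewrite !hE // => t te; split; apply: contraTneq te => ->.
Qed.

Lemma update_pair y (k : 'I_m) u v : exists y' : triples,
  [/\ y' (before k) = u, y' (after k) = v &
      forall t, t != before k -> t != after k -> y' t = y t].
Proof.
exists (dfwith (dfwith y u) v); split.
- by rewrite dfwith_out ?dfwith_in // eq_sym before_after.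
- by rewrite dfwith_in.
- by move=> t h1 h2; rewrite !dfwith_out // eq_sym.
Qed.

(** A shift at the level of elements is a walk at one gap; the coordinates of
    the two elements concerned change and all others are kept. *)
Lemma step_link x y zs : irred (tseq y) -> shift (tseq y) zs \/ shift zs (tseq y) ->
  exists y', zs = tseq y' /\ (linked x y -> linked x y').
Proof.
move=> iy h.
have iz : irred zs by case: h => /irred_shift hz; apply/hz.
case: h => -[l1 [r [z [r' [l2 [yE zE h1 h2]]]]]].
- have [k [p1 p2 hk]] := tseq_pair yE.
  have [r1 rr] : r <> 1 /\ regular r.
    by apply: iz.1; rewrite zE mem_cat inE eqxx orbT.
  have [_ rr'] : r' <> 1 /\ regular r'.
    by apply: iy.1; rewrite yE mem_cat !inE eqxx !orbT.
  have [x1 x1E] := emb_surj r1.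
  have d1 : D (before k) x1.
    apply: (Dclass_R (DD _)) (crdD (y (before k))); apply: greenR_sym.
    by apply: (@greenR_rc _ _ _ _ z); rewrite x1E.
  case E1: (y (before k)) => [[i0 g] l]; case E2: (y (after k)) => [[i h0] nu].
  rewrite -x1E in h1 p1 zE rr; rewrite p2 in h2 rr' zE.
  have [n [a [b [mu [j [w xE zE']]]]]] := step_word (DD _) (DD _) d1
    (crdD (y (after k))) ((regular_eltE _).2 rr) ((regular_eltE _).2 rr')
    (z := repr z) (i0 := i0) (g := g) (l := l) (C2 := C (after k)) ltac:(by rewrite evK)
    ltac:(by rewrite evK) ltac:(by rewrite evK p1 E1) (congr1 (@crd _ _ _) E2).
  have [y' [y1 y2 hy]] := update_pair y (i0, g * a, mu) (j, (b : crd_grp _) * h0, nu).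
  exists y'; split; first by rewrite hk // y1 y2 zE xE -zE' evK.
  apply: (linked_step hy (a := a) (b := b) (n := n)); rewrite ?y1 ?y2 ?E1 ?E2 //.
- move: yE zE => zE yE; have [k [p1 p2 hk]] := tseq_pair yE.
  have [_ rr] : r <> 1 /\ regular r.
    by apply: iy.1; rewrite yE mem_cat inE eqxx orbT.
  have [r1 rr'] : r' <> 1 /\ regular r'.
    by apply: iz.1; rewrite zE mem_cat !inE eqxx !orbT.
  have [x2 x2E] := emb_surj r1.
  have d2 : D (after k) x2.
    apply: (Dclass_L (DD _)) (crdD (y (after k))); apply: greenL_sym.
    by apply: (@greenL_lc _ _ _ _ z); rewrite x2E.
  have [x1 x1E] : exists x1 : IG B, emb x1 = r * z.
    by apply: emb_surj => /mul_eq1 [r0 _]; apply: (@emb_neq1 _ _ (crd (y (before k)))); rewrite -p1.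
  have d1 : D (before k) x1.
    apply: (Dclass_R (DD _)) (crdD (y (before k))).
    by apply: (@greenR_rc _ _ _ _ z); rewrite -p1.
  have [[[i0 g] l] E1] := crd_onto (C _) d1.
  have [[[i h0] nu] E2] := crd_onto (C _) d2.
  rewrite p1 in x1E h1 rr; rewrite -x2E in h2 p2 zE rr'.
  have [n [a [b [mu [j [w xE zE']]]]]] := step_word (DD _) (DD _) (crdD (y (before k)))
    d2 ((regular_eltE _).2 rr) ((regular_eltE _).2 rr')
    (z := repr z) (i0 := i0) (g := g) (l := l) (C2 := C (after k)) ltac:(by rewrite evK)
    ltac:(by rewrite evK) ltac:(by rewrite evK E1 x1E) (esym E2).
  have [y' [y1 y2 hy]] := update_pair y (i0, g, l) (i, h0, nu).
  have {}xE := crd_inj xE.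
  have {}zE' : y (after k) = (j, (b : crd_grp _) * h0, nu).
    by apply: crd_inj; apply: emb_inj; rewrite -zE' evK p2.
  exists y'; split; first by rewrite hk // y1 y2 E1 E2 zE x1E -p1.
  have wr := walk_rev w.
  apply: (linked_step hy (a := a^-1) (b := (b : crd_grp _)^-1) (n := n));
    rewrite ?y1 ?y2 ?xE ?zE' ?mulgK ?mulKg //.
Qed.

Lemma tseq_inj y y' : tseq y = tseq y' -> y = y'.
Proof.
move=> h; apply: functional_extensionality_dep => k.
apply: crd_inj; apply: emb_inj.
by move: h => /eq_in_map; apply; rewrite mem_enum.
Qed.

Lemma equal_linked x y : irreducible_rseq (fun k => crd (x k)) ->
  irreducible_rseq (fun k => crd (y k)) ->
  ordprod (fun k => crd (x k)) ord0 ord_max = ordprod (fun k => crd (y k)) ord0 ord_max ->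
  linked x y.
Proof.
move=> /irreducible_irred ix /irreducible_irred iy /(congr1 emb).
rewrite !emb_ordprod_all => h.
have lkxy : shifts (tseq x) (tseq y).
  have pE z : \prod_(t <- tseq z) t = \prod_(k <- enum 'I_m.+1) emb (crd (z k)).
    exact: big_map.
  by apply: irreducible_linked => //; rewrite !pE.
suff [y' [/tseq_inj -> //]] : exists y', tseq y = tseq y' /\ linked x y'.
have : exists y', tseq x = tseq y' /\ linked x y'.
  by exists x; split=> //; apply: linked_refl.
rewrite -/(tseq x) in ix; elim: lkxy ix => // xs ys zs st _ IH irx [x' [xE lx]]; subst xs.
have [y' [yE hy]] := step_link x irx st.
apply: IH; last by exists y'; split=> //; apply: hy.
by case: st => /irred_shift hz; apply/hz.
Qed.

(** The walks at the successive gaps are performed from left to right; before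
    gap [t] the element at position [t] carries the unknown [X t] as a left
    factor of its group coordinate. *)
Lemma linked_equal x y : linked x y ->
  ordprod (fun k => crd (x k)) ord0 ord_max = ordprod (fun k => crd (y k)) ord0 ord_max.
Proof.
move=> [h1 h2 [X [X0 Xm XS]]]; apply: emb_inj; rewrite !emb_ordprod_all.
pose mid t := emb (crd ((y t).1.1, X t * (x t).1.2, (x t).2)).
have key e1 t e2 : enum 'I_m.+1 = e1 ++ t :: e2 ->
    \prod_(k <- enum 'I_m.+1) emb (crd (x k)) =
    \prod_(k <- e1) emb (crd (y k)) * mid t * \prod_(k <- e2) emb (crd (x k)).
  elim/last_ind: e1 t e2 => [|e1 t' IH] t e2 eE.
    have : t = ord0 by move: eE; rewrite enum_ordSl => -[<-].
    move=> ?; subst t; rewrite eE big_nil mul1g big_cons /mid X0 mul1g -h1.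
    by case: (x ord0) => [[]].
  rewrite cat_rcons in eE; rewrite (IH _ _ eE) !big_cons big_rcons /= -!mulgA.
  congr (_ * _); rewrite !mulgA; congr (_ * _).
  have [k [? ?]] := enum_pair eE; subst t t'.
  have [n w] := XS k; have := walk_acts w.
  move=> /(_ (y (before k)).1.1 (X (before k) * (x (before k)).1.2)
    (x (after k)).1.2 (x (after k)).2) /= wE.
  rewrite /mid -!emb_mul; congr emb; move: wE.
  rewrite !mulgA mulgK mulgV mul1g.
  by case: (y (before k)) => [[]] /= ? ? ?; case: (x (after k)) => [[]].
have eE : enum 'I_m.+1 = map (widen_ord (leqnSn m)) (enum 'I_m) ++ [:: ord_max].
  by rewrite enum_ordSr cats1.
rewrite (key _ _ _ eE) big_nil mulg1 [in RHS]eE big_cat big_seq1; congr (_ * _).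
rewrite /mid Xm mulgVK h2; by case: (y ord_max) => [[]].
Qed.

End Main.

(** * A rational expression for the walk labels *)

Section Denotes.
Variables (A : Type) (M : monoidType) (val : A -> M -> Prop).

Lemma mulset1 (a b : M) : mulset [set a] [set b] = [set a * b].
Proof.
apply/seteqP; split=> x /=; first by move=> [? [? [-> -> ->]]].
by move=> ->; exists a, b.
Qed.

Hypothesis val_fun : forall a x y, val a x -> val a y -> x = y.

(** Letters name at most one element, so an expression has at most one value. *)
Lemma denotes_fun r X Y : denotes val r X -> denotes val r Y -> X = Y.
Proof.
move=> h; elim: h Y => [|||r' s X1 X2 _ IH1 _ IH2|r' s X1 X2 _ IH1 _ IH2|r' X1 _ IH1].
- by move=> Y h; inversion h.
- by move=> Y h; inversion h.
- move=> a x ax Y h; inversion h; subst; congr [set _]; exact: val_fun ax _.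
- by move=> Y h; inversion h; subst; rewrite (IH1 _ H1) (IH2 _ H3).
- by move=> Y h; inversion h; subst; rewrite (IH1 _ H1) (IH2 _ H3).
- by move=> Y h; inversion h; subst; rewrite (IH1 _ H0).
Qed.

Lemma denotes_rational r X : denotes val r X -> rational X.
Proof.
elim=> [||a x _|? ? ? ? _ h1 _ h2|? ? ? ? _ h1 _ h2|? ? _ h1].
- exact: rational_fin (finite_set0 _).
- exact: rational_fin (finite_set1 _).
- exact: rational_fin (finite_set1 _).
- exact: rational_U.
- exact: rational_M.
- exact: rational_star.
Qed.

Lemma submonoid_gen_mul (X : set M) x y :
  submonoid_gen X x -> submonoid_gen X y -> submonoid_gen X (x * y).
Proof.
elim=> [|a z Xa _ IH] hy; first by rewrite mul1g.
by rewrite -mulgA; apply: submonoid_M => //; apply: IH.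
Qed.

Lemma submonoid_gen1 (X : set M) x : X x -> submonoid_gen X x.
Proof. by move=> h; rewrite -[x]mulg1; apply: submonoid_M => //; apply: submonoid_1. Qed.

End Denotes.

Section Algorithm.
Variables (E : finType) (B : biordered E).
Implicit Types (p q c : E * E).
Notation word := (seq ((E * E) * (E * E))).

Definition eqL (f g : E) := (bop B f g == Some f) && (bop B g f == Some g).
Definition eqR (f g : E) := (bop B f g == Some g) && (bop B g f == Some f).

Definition lab_exp p q : ratexp (letter2 E) :=
  RProd (RSym (inl (p.1, true))) (RProd (RSym (inl (q.1, false)))
    (RProd (RSym (inr (p.2, true))) (RSym (inr (q.2, false))))).

Definition word_exp (w : word) : ratexp (letter2 E) :=
  foldl (fun r e => RProd r (lab_exp e.1 e.2)) REps w.

(** Different pairs of generators may name the same state; this is decided in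
    the table. *)
Definition same_state c p := eqL c.1 p.1 && eqR c.2 p.2.

Definition fmap (S T : Type) (s : seq S) (f : S -> seq T) := flatten (map f s).

(** All walks prolonged by at most one edge. Only edges leaving states already
    reached are used, so that every letter of the words has a value in the
    groups. *)
Definition extend (W : seq ((E * E) * word)) :=
  W ++ fmap W (fun w => fmap (enum E) (fun p1 : E => fmap (enum E) (fun p2 : E =>
    fmap (enum E) (fun q1 : E => fmap (enum E) (fun q2 : E =>
      if same_state w.1 (p1, p2) && edge B (p1, p2) (q1, q2)
      then [:: ((q1, q2), rcons w.2 ((p1, p2), (q1, q2)))] else [::]))))).

Definition union_exp (ws : seq word) : ratexp (letter2 E) :=
  foldr (fun w r => RUnion (word_exp w) r) RVoid ws.

Definition words_to (W : seq ((E * E) * word)) c :=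
  [seq w.2 | w <- W & same_state w.1 c].

Definition walks n c := iter n extend [:: (c, [::])].

(** Closed walks composed of a short walk, an edge and a short walk back
    suffice, where short walks have fewer than [|E|^2] edges. The bound has
    the form in which two nested loops over the table and a double step
    perform it. *)
Definition nsteps := (#|E| * (#|E| * 2))%N.

(** Products of labels of short closed walks at the initial state, followed by
    a label of a short walk to the final state. *)
Definition rho_exp (el ei emu ej : E) :=
  let W := walks nsteps (el, ei) in
  RProd (RStar (union_exp (words_to W (el, ei)))) (union_exp (words_to W (emu, ej))).

Lemma mem_fmap (S T : eqType) (s : seq S) (f : S -> seq T) y :
  y \in fmap s f <-> exists2 x, x \in s & y \in f x.
Proof. by split=> [/flatten_mapP|h]; last apply/flatten_mapP. Qed.

Lemma mem_extend W c (w : word) : (c, w) \in extend W <->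
  (c, w) \in W \/ exists c0 w0 p, [/\ (c0, w0) \in W, same_state c0 p, edge B p c &
    w = rcons w0 (p, c)].
Proof.
rewrite /extend mem_cat; split.
- case/orP => [|/mem_fmap[[c0 w0] h
    /mem_fmap[p1 _ /mem_fmap[p2 _ /mem_fmap[q1 _ /mem_fmap[q2 _]]]]]].
    by left.
  case: ifP => // /andP[h1 h2]; rewrite inE => /eqP[-> ->].
  by right; exists c0, w0, (p1, p2).
- case=> [->//|[c0 [w0 [[p1 p2] [h1 h2 h3 ->]]]]]; apply/orP; right.
  case: c h3 => q1 q2 h3.
  apply/mem_fmap; exists (c0, w0) => //.
  apply/mem_fmap; exists p1; first by rewrite mem_enum.
  apply/mem_fmap; exists p2; first by rewrite mem_enum.
  apply/mem_fmap; exists q1; first by rewrite mem_enum.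
  apply/mem_fmap; exists q2; first by rewrite mem_enum.
  by rewrite h2 h3 inE.
Qed.

Section Correct.
Variables (D1 D2 : set (IG B)).
Hypotheses (DD1 : is_Dclass D1) (DD2 : is_Dclass D2).
Variables (C1 : coordinatisation D1) (C2 : coordinatisation D2).
Local Notation gn := (gn B).
Local Notation emb := (@emb _ B).
Local Notation G := (crd_grp C1 * dual_group (crd_grp C2))%type.
Local Notation st := (crd_L C1 * crd_I C2)%type.
Local Notation at_state := (@at_state _ _ _ _ C1 C2).
Local Notation lab := (@lab _ _ _ _ C1 C2).
Local Notation denotes := (Defs.denotes (@letter2_val E B _ _ C1 C2)).
Implicit Types (s : st) (x y : G).

Lemma letter_val_fun (D : set (IG B)) (C : coordinatisation D) a (x y : crd_grp C) :
  @letter_val _ _ _ C a x -> @letter_val _ _ _ C a y -> x = y.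
Proof.
case: a => e b h; have [i [l [f [[g [l' hi]] _ _ _]]]] := h.
have hn : names C e i g l' by rewrite /names hi.
by move: h => /(letter_names hn) -> /(letter_names hn) ->.
Qed.

Lemma letter2_val_fun a x y :
  @letter2_val E B _ _ C1 C2 a x -> @letter2_val E B _ _ C1 C2 a y -> x = y.
Proof.
case: x y a => [x1 x2] [y1 y2] [a|a] /= [h1 h2] [h3 h4]; congr (_, _).
- exact: letter_val_fun h1 h3.
- by rewrite h2 h4.
- by rewrite h1 h3.
- exact: letter_val_fun h2 h4.
Qed.

Lemma eqLP f g : eqL f g <-> greenL (ig_gen B f) (ig_gen B g).
Proof.
split=> [/andP[/eqP/bop_gn h1 /eqP/bop_gn h2]|[/leLP[a] + /leLP[b]]].
  by split; apply/leLP; rewrite !emb_gen; [exists (gn f)|exists (gn g)].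
rewrite !emb_gen => fE gE.
have h1 : gn f * gn g = gn f by rewrite fE -mulgA gn_idem.
have h2 : gn g * gn f = gn g by rewrite gE -mulgA gn_idem.
by apply/andP; split; apply/eqP/bopE; split=> //; apply: Or41.
Qed.

Lemma eqRP f g : eqR f g <-> greenR (ig_gen B f) (ig_gen B g).
Proof.
split=> [/andP[/eqP/bop_gn h1 /eqP/bop_gn h2]|[/leRP[a] + /leRP[b]]].
  by split; apply/leRP; rewrite !emb_gen; [exists (gn f)|exists (gn g)].
rewrite !emb_gen => fE gE.
have h1 : gn f * gn g = gn g by rewrite {1}gE mulgA gn_idem -gE.
have h2 : gn g * gn f = gn f by rewrite {1}fE mulgA gn_idem -fE.
by apply/andP; split; apply/eqP/bopE; split=> //; apply: Or42.
Qed.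

Lemma same_stateP c p s : at_state c s -> same_state c p <-> at_state p s.
Proof.
move=> [[k [v h1]] [a [n h2]]]; split=> [/andP[/eqLP e1 /eqRP e2]|[[k' [v' h3]] [a' [n' h4]]]].
  have d1 : D1 (ig_gen B p.1) by apply: Dclass_L e1 _ => //; rewrite h1; apply: crdD.
  have d2 : D2 (ig_gen B p.2) by apply: Dclass_R e2 _ => //; rewrite h2; apply: crdD.
  have [[[k' v'] l'] h3] := crd_onto C1 d1.
  have [[[a' b'] n'] h4] := crd_onto C2 d2.
  split.
    exists k', v'; rewrite -h3; congr (crd (_, _, _)).
    by apply: ((@crd_greenL _ _ C1 (k', v', l') (k, v, s.1)).1 _); rewrite h3 -h1; case: e1.
  exists b', n'; rewrite -h4; congr (crd (_, _, _)).
  by apply: ((@crd_greenR _ _ C2 (a', b', n') (s.2, a, n)).1 _); rewrite h4 -h2; case: e2.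
apply/andP; split.
  by apply/eqLP; rewrite h1 h3; apply/crd_greenL.
by apply/eqRP; rewrite h2 h4; apply/crd_greenR.
Qed.

Lemma at_state_fun c s s' : at_state c s -> at_state c s' -> s = s'.
Proof.
move=> [[k [v h1]] [a [n h2]]] [[k' [v' h1']] [a' [n' h2']]].
move: h1' h2'; rewrite h1 h2 => /crd_inj[_ _ hl] /crd_inj[hi _ _].
by case: s s' hl hi {h1 h2} => [? ?] [? ?] /= -> ->.
Qed.

Lemma edge_state p q s : edge B p q -> at_state p s ->
  exists s' y, at_state q s' /\ lab p q y.
Proof.
move=> pq /[dup] ps [[k [v h1]] [a [n h2]]].
have d1 : D1 (ig_gen B p.1) by rewrite h1; apply: crdD.
have d2 : D2 (ig_gen B p.2) by rewrite h2; apply: crdD.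
have [r1 l2] : greenR (ig_gen B p.1) (ig_gen B q.1) /\
    greenL (ig_gen B p.2) (ig_gen B q.2).
  have key p' q' : medge B p' q' -> greenR (ig_gen B p'.1) (ig_gen B q'.1) /\
      greenL (ig_gen B p'.2) (ig_gen B q'.2).
    move=> /existsP[e /and4P[/eqP/bop_gn e1 /eqP/bop_gn e2 /eqP/bop_gn e3 /eqP/bop_gn e4]].
    split.
      apply: greenR_sym; apply: (@greenR_rc _ _ _ _ (gn e)); rewrite ?emb_gen //.
      by exists (gn q'.1); rewrite e1 gn_idem.
    apply: (@greenL_lc _ _ _ _ (gn e)); rewrite ?emb_gen //.
    by exists (gn p'.2); rewrite e3 gn_idem.
  case/orP: pq => /key[] //; by split; [apply: greenR_sym|apply: greenL_sym].
have [[[k' v'] l'] h3] := crd_onto C1 (Dclass_R DD1 r1 d1).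
have [[[a' b'] n'] h4] := crd_onto C2 (Dclass_L DD2 l2 d2).
exists (l', a'), (v^-1 * v', ((b' * a^-1 : crd_grp C2) : dual_group _)); split.
  by split; [exists k', v'|exists b', n'].
by apply/(@lab_names _ _ _ _ C1 C2 p q _ k v s.1 k' v' l' s.2 a n a' b' n').
Qed.

Lemma denotes_lab p q y : lab p q y -> denotes (lab_exp p q) [set y].
Proof.
case: y => y1 y2 [[a [b [ha hb /= ->]]] [c [d [hc hd /= ->]]]].
have -> : (a * b, (c : dual_group _) * (d : dual_group _)) =
   ((a, 1) : G) * (((b, 1) : G) * (((1, c) : G) * ((1, d) : G))).
  by congr (_, _); rewrite /= ?mul1g ?mulg1.
rewrite -!mulset1; do 3! [apply: denotes_prod; first by apply: denotes_sym].
by apply: denotes_sym.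
Qed.

Variables (el ei : E) (s0 : st).
Hypothesis hs0 : at_state (el, ei) s0.
Local Notation walk := (@walk _ _ _ _ C1 C2).

Lemma walks_sound n c w : (c, w) \in walks n (el, ei) ->
  exists s x k, [/\ at_state c s, walk k s0 x s, (k <= n)%N & denotes (word_exp w) [set x]].
Proof.
elim: n c w => [|n IH] c w.
  rewrite inE => /eqP[-> ->]; exists s0, 1, 0; split=> //; first exact: walk0.
  exact: denotes_eps.
rewrite [walks _ _]/(extend (walks n (el, ei))) => /mem_extend[/IH|].
  by move=> [s [x [k [h1 h2 h3 h4]]]]; exists s, x, k; split=> //; apply: leqW.
move=> [c0 [w0 [p [/IH [s [x [k [h1 h2 h3 h4]]]] cp pc ->]]]].
have ps := (same_stateP p h1).1 cp.
have [s' [y [cs' ly]]] := edge_state pc ps.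
exists s', (x * y), k.+1; split=> //; first exact: walkS h2 pc ps cs' ly.
rewrite /word_exp foldl_rcons -mulset1; apply: denotes_prod => //.
exact: denotes_lab.
Qed.

Lemma walks_complete n k s x : walk k s0 x s -> (k <= n)%N ->
  exists c w, [/\ (c, w) \in walks n (el, ei), at_state c s & denotes (word_exp w) [set x]].
Proof.
move: {-1}s0 (erefl s0) => t tE w.
elim: w tE n => [t'|{}k t' {}x s' p q y s'' w IH pq ps qs lb] tE n kn.
  subst t'; exists (el, ei), [::]; split=> //; last exact: denotes_eps.
  elim: n {kn} => [|n IH]; first by rewrite inE.
  by rewrite [walks _ _]/(extend (walks n (el, ei))); apply/mem_extend; left.
case: n kn => // n kn; have [c [w0 [h1 h2 h3]]] := IH tE n kn.
exists q, (rcons w0 (p, q)); split=> //.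
  rewrite [walks _ _]/(extend (walks n (el, ei))); apply/mem_extend; right.
  by exists c, w0, p; split=> //; apply/(same_stateP p h2).
rewrite /word_exp foldl_rcons -mulset1; apply: denotes_prod => //.
exact: denotes_lab.
Qed.

Definition adj : rel (E * E) := fun c q => [exists p, same_state c p && edge B p q].

(** A walk without repetition through pairs of names of states has fewer than
    [|E|^2] edges. *)
Lemma walk_short n x s : walk n s0 x s ->
  exists m y, (m < #|E| * #|E|)%N /\ walk m s0 y s.
Proof.
move=> w.
have [c [cs hc]] : exists c, at_state c s /\ connect adj (el, ei) c.
  move: {-1}s0 (erefl s0) w => t tE w.
  elim: w tE => [t'|{}n t' {}x s' p q y s'' w IH pq ps qs lb] tE.
    by subst t'; exists (el, ei).
  have [c [cs hc]] := IH tE; exists q; split=> //.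
  apply: connect_trans hc (connect1 _); apply/existsP; exists p; rewrite pq andbT.
  exact/(same_stateP p cs).
have [cs' pth] := connectP hc.
case/shortenP: pth => ps pp up _ cE.
have : (size ((el, ei) :: ps) <= #|{: E * E}|)%N.
  by rewrite -(card_uniqP up) max_card.
move=> /= sz; exists (size ps).
suff [t [y [ct h]]] : exists t y, at_state (last (el, ei) ps) t /\ walk (size ps) s0 y t.
  exists y; rewrite card_prod in sz; split=> //; congr (walk _ _ _ _): h.
  by apply: (at_state_fun ct); rewrite -cE.
elim/last_ind: ps pp {up cE sz} => [|ps q IH] pp; first by exists s0, 1; split=> //; apply: walk0.
move: pp; rewrite rcons_path => /andP[/IH[t [y [ct h]]] /existsP[p /andP[sp pq]]].
have pt := (same_stateP p ct).1 sp.
have [t' [y' [ct' ly]]] := edge_state pq pt.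
exists t', (y * y'); rewrite last_rcons size_rcons; split=> //.
exact: walkS h pq pt ct' ly.
Qed.

Lemma denotes_union_exp (ws : seq word) :
  (forall w, w \in ws -> exists x, denotes (word_exp w) [set x]) ->
  denotes (union_exp ws) [set x | exists2 w, w \in ws & denotes (word_exp w) [set x]].
Proof.
elim: ws => [|w ws IH] h.
  rewrite [X in denotes _ X](_ : _ = set0); first exact: denotes_void.
  by apply/seteqP; split=> x // [].
have [x hx] : exists x, denotes (word_exp w) [set x] by apply: h; rewrite inE eqxx.
rewrite [X in denotes _ X](_ : _ = [set x] `|`
    [set x | exists2 w, w \in ws & denotes (word_exp w) [set x]]).
  by apply: denotes_union => //; apply: IH => v hv; apply: h; rewrite inE hv orbT.
apply/seteqP; split=> y /=.
  move=> [v]; rewrite inE => /orP[/eqP->|hv] hy; last by right; exists v.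
  left; have /seteqP[hh _] := denotes_fun letter2_val_fun hy hx.
  exact: hh.
move=> [->|[v hv hy]]; first by exists w; rewrite ?inE ?eqxx.
by exists v => //; rewrite inE hv orbT.
Qed.

Lemma denotes_words_to n c s : at_state c s ->
  denotes (union_exp (words_to (walks n (el, ei)) c))
    [set x | exists2 k, (k <= n)%N & walk k s0 x s].
Proof.
move=> cs.
have mem w : w \in words_to (walks n (el, ei)) c <->
    exists2 c', (c', w) \in walks n (el, ei) & same_state c' c.
  split=> [/mapP[[c' w'] + ->]|[c' h1 h2]].
    by rewrite mem_filter => /andP[/= h1 h2]; exists c'.
  by apply/mapP; exists (c', w); rewrite ?mem_filter ?h1 ?andbT.
have sound w : w \in words_to (walks n (el, ei)) c -> exists x,
    denotes (word_exp w) [set x] /\ exists2 k, (k <= n)%N & walk k s0 x s.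
  move=> /mem [c' /walks_sound[s' [x [k [h1 h2 h3 h4]]]] /(same_stateP _ h1) h5].
  exists x; split=> //; exists k => //.
  by rewrite (at_state_fun cs h5).
rewrite [X in denotes _ X](_ : _ = [set x | exists2 w, w \in words_to (walks n (el, ei)) c &
  denotes (word_exp w) [set x]]).
  by apply: denotes_union_exp => w /sound[x [h _]]; exists x.
apply/seteqP; split=> x /= [].
  move=> k kn /walks_complete /(_ kn) [c' [w [h1 h2 h3]]]; exists w => //.
  by apply/mem; exists c' => //; apply/(same_stateP _ h2).
move=> w /sound [y [h1 h2] h3].
have /seteqP[hh _] := denotes_fun letter2_val_fun h3 h1.
by rewrite (hh x).
Qed.

(** By induction on a walk, its label is [h y] with [h] a product of labels of
    short closed walks and [y] the label of a short walk. A further edge [l]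
    is absorbed by [h y l = h (y l z^-1) z], where [z] is the label of a short
    walk to the new endpoint. *)
Lemma denotes_rho emu ej s : at_state (emu, ej) s ->
  denotes (rho_exp el ei emu ej) [set x | exists n, walk n s0 x s].
Proof.
move=> hs.
rewrite [X in denotes _ X](_ : _ = mulset
  (submonoid_gen [set x | exists2 k, (k <= nsteps)%N & walk k s0 x s0])
  [set x | exists2 k, (k <= nsteps)%N & walk k s0 x s]).
  by apply: denotes_prod; [apply: denotes_star|]; apply: denotes_words_to.
apply/seteqP; split=> x /=; last first.
  move=> [h [y [hh [k _ w] ->]]].
  have [n w'] : exists n, walk n s0 h s0.
    elim: hh => [|a z [k' _ w'] _ [n' wz]]; first by exists 0; apply: walk0.
    by exists (k' + n')%N; apply: walk_cat w' wz.
  by exists (n + k)%N; apply: walk_cat w' w.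
move=> [n w].
suff [h [y [m [hh hm wy ->]]]] : exists h y m,
    [/\ submonoid_gen [set x | exists2 k, (k <= nsteps)%N & walk k s0 x s0] h,
        (m < #|E| * #|E|)%N, walk m s0 y s & x = h * y].
  exists h, y; split=> //; exists m => //; rewrite /nsteps; nia.
move: {-1}s0 (erefl s0) w => t tE w.
elim: w tE {hs} => [t'|{}n t' {}x s' p q l s'' w IH pq ps qs lb] tE; subst t'.
  have [m [y [h1 h2]]] := walk_short (walk0 s0).
  exists 1, 1, 0; split; [exact: submonoid_1|lia|exact: walk0|by rewrite mulg1].
have [h [y [m [hh hm wy ->]]]] := IH erefl.
have [m' [z [hm' wz]]] := walk_short (walkS w pq ps qs lb).
exists (h * (y * l * z^-1)), z, m'; split=> //; last by rewrite !mulgA mulgVK.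
apply: submonoid_gen_mul => //; apply: submonoid_gen1.
exists (m.+1 + m')%N; first by rewrite /nsteps; nia.
exact: walk_cat (walkS wy pq ps qs lb) (walk_rev wz).
Qed.

End Correct.
End Algorithm.

(** * Computable functions on trees *)

(* Elsewhere these names abbreviate sequences and generic trees. *)
Local Notation tree := Defs.tree.
Local Notation Nil := Defs.Nil.
Local Notation Cons := Defs.Cons.

(** Functions on trees that are computed by some program on every input;
    closing this class under recursion on lists replaces writing programs. *)
Definition computable (f : tree -> tree) := exists p, forall x, runs p x (f x).

Lemma comp_id : computable (fun x => x).
Proof. by exists PId => x; apply: runs_id. Qed.
Lemma comp_nil : computable (fun=> Nil).
Proof. by exists PNil => x; apply: runs_nil. Qed.
Lemma comp_comp f g : computable f -> computable g -> computable (fun x => f (g x)).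
Proof.
move=> [p hp] [q hq]; exists (PSeq q p) => x.
exact: runs_seq (hq x) (hp _).
Qed.
Lemma comp_hd f : computable f -> computable (fun x => hd (f x)).
Proof. by apply: (comp_comp (f := hd)); exists PHd => x; apply: runs_hd. Qed.
Lemma comp_tl f : computable f -> computable (fun x => tl (f x)).
Proof. by apply: (comp_comp (f := tl)); exists PTl => x; apply: runs_tl. Qed.
Lemma comp_cons f g : computable f -> computable g -> computable (fun x => Cons (f x) (g x)).
Proof.
by move=> [p hp] [q hq]; exists (PCons p q) => x; apply: runs_cons.
Qed.

Definition tif (c a b : tree) : tree := if c is Cons _ _ then a else b.

Lemma comp_if c f g : computable c -> computable f -> computable g ->
  computable (fun x => tif (c x) (f x) (g x)).
Proof.
move=> [pc hc] [p hp] [q hq]; exists (PIf pc p q) => x.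
have := hc x; case: (c x) => [|a b] h /=; first exact: runs_if_false h (hq x).
exact: runs_if_true h (hp x).
Qed.

Fixpoint foldt (G : tree -> tree -> tree) (l acc : tree) : tree :=
  if l is Cons a l' then foldt G l' (G a acc) else acc.

(** The loop keeps the remaining list, the accumulator and the environment;
    the body sees the current element, the accumulator and the environment
    packed in one tree. *)
Lemma comp_foldt (F : tree -> tree -> tree -> tree) l i :
  computable (fun v => F (hd v) (hd (tl v)) (tl (tl v))) -> computable l -> computable i ->
  computable (fun x => foldt (fun a acc => F a acc x) (l x) (i x)).
Proof.
move=> [b hb] [pl hl] [pi hi].
pose step := PCons (PSeq PHd PTl) (PCons (PSeq (PCons (PSeq PHd PHd) PTl) b) (PSeq PTl PTl)).
exists (PSeq (PCons pl (PCons pi PId)) (PSeq (PWhile PHd step) (PSeq PTl PHd))) => x.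
apply: runs_seq; first by apply: runs_cons (hl x) (runs_cons (hi x) (runs_id x)).
move: (l x) (i x) => t acc.
apply: (@runs_seq _ _ _ (Cons Nil (Cons (foldt (fun a c => F a c x) t acc) x))).
  elim: t acc => [|a _ t IH] acc; first exact/runs_while_stop/runs_hd.
  apply: runs_while_step (IH _); first exact: runs_hd.
  have seq1 p q z : runs p z (hd z) -> runs q (hd z) (tl (hd z)) ->
    runs (PSeq p q) z (tl (hd z)) by move=> h1 h2; apply: runs_seq h1 h2.
  apply: runs_cons; first by apply: runs_seq (runs_hd _) (runs_tl _).
  apply: runs_cons; last by apply: runs_seq (runs_tl _) (runs_tl _).
  apply: runs_seq; first apply: runs_cons (runs_tl _).
    by apply: runs_seq (runs_hd _) (runs_hd _).
  exact: hb.
by apply: runs_seq (runs_tl _) (runs_hd _).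
Qed.

(** Functions of several arguments are computed on packed arguments. *)
Definition comp2 F := computable (fun v => F (hd v) (tl v)).
Definition comp4 F := computable (fun v =>
  F (hd v) (hd (tl v)) (hd (tl (tl v))) (tl (tl (tl v)))).
Definition comp5 F := computable (fun v =>
  F (hd v) (hd (tl v)) (hd (tl (tl v))) (hd (tl (tl (tl v)))) (tl (tl (tl (tl v))))).

Lemma comp2_app F a b : comp2 F ->
  computable a -> computable b -> computable (fun x => F (a x) (b x)).
Proof.
move=> hF ha hb.
exact: (@comp_comp (fun v => F (hd v) (tl v)) (fun x => Cons (a x) (b x)) hF
  (comp_cons ha hb)).
Qed.
Lemma comp4_app F a b c d : comp4 F ->
  computable a -> computable b -> computable c -> computable d ->
  computable (fun x => F (a x) (b x) (c x) (d x)).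
Proof.
move=> hF ha hb hc hd'.
exact: (comp_comp hF (comp_cons ha (comp_cons hb (comp_cons hc hd')))).
Qed.
Lemma comp5_app F a b c d e : comp5 F ->
  computable a -> computable b -> computable c -> computable d -> computable e ->
  computable (fun x => F (a x) (b x) (c x) (d x) (e x)).
Proof.
move=> hF ha hb hc hd' he.
exact: (comp_comp hF (comp_cons ha (comp_cons hb (comp_cons hc (comp_cons hd' he))))).
Qed.

Ltac comp_step := first
  [ exact: comp_id | exact: comp_nil
  | apply: comp_cons | apply: comp_if | apply: comp_hd | apply: comp_tl ].

Definition trev l := foldt (fun a acc => Cons a acc) l Nil.
Definition tapp a b := foldt (fun x acc => Cons x acc) (trev a) b.
Definition tmapcat F l := foldt (fun a acc => tapp (F a) acc) (trev l) Nil.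
Definition tlen l := foldt (fun _ c => Cons Nil c) l Nil.
(** A number is encoded by a list of that length, so folding over it iterates. *)
Definition tdrop n l := foldt (fun _ acc => tl acc) n l.
Definition ttrue := Cons Nil Nil.
Definition teqn a b := tif (tdrop a b) Nil (tif (tdrop b a) Nil ttrue).
Definition tbop T e f := hd (tdrop f (hd (tdrop e T))).
Definition tbopis T e f g := tif (tbop T e f) (teqn (hd (tbop T e f)) g) Nil.
Definition tand a b := tif a b Nil.
Definition tor a b := tif a ttrue b.
(** The table has one row per element, so its length gives the list of the
    encodings of all elements. *)
Definition telems T := foldt (fun _ acc => tapp acc (Cons (tlen acc) Nil)) T Nil.

Lemma comp_trev l : computable l -> computable (fun x => trev (l x)).
Proof.
move=> hl; apply: (@comp_foldt (fun a acc _ => Cons a acc)) => //; repeat comp_step.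
Qed.
Lemma comp_tapp a b : computable a -> computable b -> computable (fun x => tapp (a x) (b x)).
Proof.
move=> ha hb; apply: (@comp_foldt (fun a acc _ => Cons a acc)) => //; repeat comp_step.
exact: comp_trev.
Qed.
Lemma comp_tmapcat F l : computable (fun v => F (hd v) (tl (tl v))) -> computable l ->
  computable (fun x => tmapcat (fun a => F a x) (l x)).
Proof.
move=> hF hl; apply: (@comp_foldt (fun a acc x => tapp (F a x) acc)).
- by apply: comp_tapp => //; repeat comp_step.
- exact: comp_trev.
- exact: comp_nil.
Qed.
Lemma comp_tlen l : computable l -> computable (fun x => tlen (l x)).
Proof.
move=> hl; apply: (@comp_foldt (fun _ c _ => Cons Nil c)) => //; repeat comp_step.
Qed.
Lemma comp_tdrop n l : computable n -> computable l -> computable (fun x => tdrop (n x) (l x)).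
Proof.
move=> hn hl; apply: (@comp_foldt (fun _ c _ => tl c)) => //; repeat comp_step.
Qed.
Lemma comp_teqn a b : computable a -> computable b -> computable (fun x => teqn (a x) (b x)).
Proof.
move=> ha hb; rewrite /teqn /ttrue; repeat comp_step; exact: comp_tdrop.
Qed.
Lemma comp_tbop T e f : computable T -> computable e -> computable f ->
  computable (fun x => tbop (T x) (e x) (f x)).
Proof.
by move=> hT he hf; apply/comp_hd/comp_tdrop => //; apply/comp_hd/comp_tdrop.
Qed.
Lemma comp_tbopis T e f g : computable T -> computable e -> computable f -> computable g ->
  computable (fun x => tbopis (T x) (e x) (f x) (g x)).
Proof.
move=> hT he hf hg; apply: comp_if; [exact: comp_tbop| |exact: comp_nil].
by apply: comp_teqn => //; apply/comp_hd/comp_tbop.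
Qed.
Lemma comp_tand a b : computable a -> computable b -> computable (fun x => tand (a x) (b x)).
Proof. by move=> ha hb; apply: comp_if => //; apply: comp_nil. Qed.
Lemma comp_tor a b : computable a -> computable b -> computable (fun x => tor (a x) (b x)).
Proof. by move=> ha hb; apply: comp_if => //; rewrite /ttrue; repeat comp_step. Qed.
Lemma comp_telems T : computable T -> computable (fun x => telems (T x)).
Proof.
move=> hT; apply: (@comp_foldt (fun _ acc _ => tapp acc (Cons (tlen acc) Nil))) => //.
  apply: comp_tapp; first by repeat comp_step.
  apply: comp_cons; last exact: comp_nil.
  by apply: comp_tlen; repeat comp_step.
exact: comp_nil.
Qed.

Ltac comp_derived_step := first
  [ apply: comp_tbopis | apply: comp_tand | apply: comp_tor | apply: comp_telems
  | apply: comp_tapp | apply: comp_trev | comp_step ].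

Definition tmedge T p1 p2 q1 q2 := foldt (fun e acc => tor
  (tand (tbopis T e q1 q1) (tand (tbopis T q1 e p1)
    (tand (tbopis T p2 e p2) (tbopis T e p2 q2)))) acc) (telems T) Nil.

Lemma comp5_tmedge : comp5 tmedge.
Proof.
apply: (@comp_foldt (fun e acc v => tor
  (tand (tbopis (hd v) e (hd (tl (tl (tl v)))) (hd (tl (tl (tl v)))))
  (tand (tbopis (hd v) (hd (tl (tl (tl v)))) e (hd (tl v)))
  (tand (tbopis (hd v) (hd (tl (tl v))) e (hd (tl (tl v))))
     (tbopis (hd v) e (hd (tl (tl v))) (tl (tl (tl (tl v)))))))) acc));
  repeat comp_derived_step.
Qed.

Definition tedge T p1 p2 q1 q2 := tor (tmedge T p1 p2 q1 q2) (tmedge T q1 q2 p1 p2).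
Lemma comp5_tedge : comp5 tedge.
Proof.
by apply: comp_tor; apply: (comp5_app comp5_tmedge); repeat comp_step.
Qed.

Definition tsame T c1 c2 p1 p2 :=
  tand (tand (tbopis T c1 p1 c1) (tbopis T p1 c1 p1))
    (tand (tbopis T c2 p2 p2) (tbopis T p2 c2 c2)).
Lemma comp5_tsame : comp5 tsame.
Proof. by rewrite /comp5 /tsame; repeat comp_derived_step. Qed.

Lemma comp_num n : computable (fun=> enc_nat n).
Proof. by elim: n => [|n IH]; [exact: comp_nil|apply: comp_cons IH; exact: comp_nil]. Qed.

Definition tprod r s := Cons (enc_nat 4) (Cons r s).
Definition tsym side e b := Cons (enc_nat 2) (Cons side (Cons e b)).
Definition tlab p1 p2 q1 q2 :=
  tprod (tsym Nil p1 ttrue) (tprod (tsym Nil q1 Nil)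
    (tprod (tsym ttrue p2 ttrue) (tsym ttrue q2 Nil))).
Lemma comp4_tlab : comp4 tlab.
Proof.
rewrite /comp4 /tlab /tprod /tsym /ttrue.
repeat (first [exact: comp_num | comp_step]).
Qed.

Definition textend T W := tapp W (tmapcat (fun w =>
  tmapcat (fun p1 => tmapcat (fun p2 => tmapcat (fun q1 => tmapcat (fun q2 =>
    tif (tand (tsame T (hd (hd w)) (tl (hd w)) p1 p2) (tedge T p1 p2 q1 q2))
      (Cons (Cons (Cons q1 q2) (tprod (tl w) (tlab p1 p2 q1 q2))) Nil) Nil)
    (telems T)) (telems T)) (telems T)) (telems T)) W).

Lemma comp2_textend : comp2 textend.
Proof.
apply: comp_tapp; first by repeat comp_step.
repeat (apply: comp_tmapcat; last by repeat comp_derived_step).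
apply: comp_if; last exact: comp_nil.
  apply: comp_tand; [apply: (comp5_app comp5_tsame)|apply: (comp5_app comp5_tedge)];
    repeat comp_step.
apply: comp_cons; last exact: comp_nil.
apply: comp_cons; first by repeat comp_step.
apply: comp_cons; first exact: comp_num.
apply: comp_cons; first by repeat comp_step.
by apply: (comp4_app comp4_tlab); repeat comp_step.
Qed.

Definition twalks T c1 c2 := foldt (fun _ acc => foldt (fun _ acc' =>
  textend T (textend T acc')) T acc) T (Cons (Cons (Cons c1 c2) (Cons (enc_nat 1) Nil)) Nil).

Definition tunion T W c1 c2 := foldt (fun w acc =>
  tif (tsame T (hd (hd w)) (tl (hd w)) c1 c2) (Cons (enc_nat 3) (Cons (tl w) acc)) acc)
  (trev W) (Cons (enc_nat 0) Nil).

Lemma comp4_tunion : comp4 tunion.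
Proof.
apply: (@comp_foldt (fun w acc v =>
  tif (tsame (hd v) (hd (hd w)) (tl (hd w)) (hd (tl (tl v))) (tl (tl (tl v))))
   (Cons (enc_nat 3) (Cons (tl w) acc)) acc)).
- apply: comp_if; first by apply: (comp5_app comp5_tsame); repeat comp_step.
    apply: comp_cons; first exact: comp_num.
    by repeat comp_step.
  by repeat comp_step.
- by repeat comp_derived_step.
- by apply: comp_cons; [exact: comp_num|exact: comp_nil].
Qed.

(** The input is the table followed by the four names. *)
Definition trho v :=
  let T := hd v in
  let el := hd (tl v) in let ei := hd (tl (tl v)) in
  let emu := hd (tl (tl (tl v))) in let ej := hd (tl (tl (tl (tl v)))) in
  tprod (Cons (enc_nat 5) (tunion T (twalks T el ei) el ei))
    (tunion T (twalks T el ei) emu ej).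

Lemma comp_twalks T c1 c2 : computable T -> computable c1 -> computable c2 ->
  computable (fun x => twalks (T x) (c1 x) (c2 x)).
Proof.
move=> hT h1 h2.
apply: (@comp_foldt (fun _ acc x => foldt (fun _ acc' =>
  textend (T x) (textend (T x) acc')) (T x) acc)) => //; last first.
  apply: comp_cons; last exact: comp_nil.
  by apply: comp_cons; apply: comp_cons => //; [exact: comp_num|exact: comp_nil].
have hT' : computable (fun v => T (tl (tl v))).
  by apply: comp_comp => //; repeat comp_step.
apply: (@comp_foldt (fun _ acc' v =>
  textend (T (tl (tl v))) (textend (T (tl (tl v))) acc'))) => //; last by repeat comp_step.
have hT2 : computable (fun v => T (tl (tl (tl (tl v))))).
  by apply: comp_comp => //; repeat comp_step.
apply: (comp2_app comp2_textend) => //; apply: (comp2_app comp2_textend) => //.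
by repeat comp_step.
Qed.

Lemma comp_trho : computable trho.
Proof.
apply: comp_cons; first exact: comp_num.
apply: comp_cons; first (apply: comp_cons; first exact: comp_num);
  apply: (comp4_app comp4_tunion); try apply: comp_twalks; repeat comp_step.
Qed.

(** * The algorithm *)

Section SeqEncodings.
Variables (T U : Type) (enc : T -> tree) (enc' : U -> tree).
Implicit Types (s : seq T).

Lemma foldt_seq G s acc :
  foldt G (enc_seq enc s) acc = foldl (fun a x => G (enc x) a) acc s.
Proof. by elim: s acc => //= x s IH acc. Qed.

Lemma trev_seq s : trev (enc_seq enc s) = enc_seq enc (rev s).
Proof.
rewrite /trev foldt_seq /rev -[Nil]/(enc_seq enc [::]).
have : forall s', foldl (fun a x => Cons (enc x) a) (enc_seq enc s') s
    = enc_seq enc (catrev s s') by elim: s => //= x s IH s'; rewrite -(IH (x :: s')).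
exact.
Qed.

Lemma foldt_trev G s acc :
  foldt G (trev (enc_seq enc s)) acc = foldr (fun x a => G (enc x) a) acc s.
Proof. by rewrite trev_seq foldt_seq foldl_rev. Qed.

Lemma tapp_seq s1 s2 : tapp (enc_seq enc s1) (enc_seq enc s2) = enc_seq enc (s1 ++ s2).
Proof. by rewrite /tapp foldt_trev; elim: s1 => //= x s1 ->. Qed.

Lemma foldt_iter G s acc : foldt (fun _ a => G a) (enc_seq enc s) acc = iter (size s) G acc.
Proof. by rewrite foldt_seq; elim: s acc => //= x s IH acc; rewrite IH -iterSr. Qed.

Lemma tdrop_seq n s : tdrop (enc_nat n) (enc_seq enc s) = enc_seq enc (drop n s).
Proof.
rewrite /tdrop; elim: n s => [|n IH] s; first by rewrite drop0.
case: s => [|x s]; last exact: IH.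
by rewrite -[RHS](IH [::]).
Qed.

Lemma hd_drop x0 s n : (n < size s)%N -> hd (enc_seq enc (drop n s)) = enc (nth x0 s n).
Proof. by elim: s n => [|x s IH] [|n] //= h; rewrite IH. Qed.

Lemma enc_seq_map (f : U -> T) (s : seq U) :
  enc_seq enc (map f s) = enc_seq (fun x => enc (f x)) s.
Proof. by elim: s => //= x s ->. Qed.

End SeqEncodings.

Lemma tmapcat_seq T U (enc : T -> tree) (enc' : U -> tree) F (f : T -> seq U) s :
  (forall x, F (enc x) = enc_seq enc' (f x)) ->
  tmapcat F (enc_seq enc s) = enc_seq enc' (fmap s f).
Proof.
move=> h; rewrite /tmapcat foldt_trev /fmap.
by elim: s => //= x s ->; rewrite h tapp_seq.
Qed.

Lemma tdrop_nat n k : tdrop (enc_nat n) (enc_nat k) = enc_nat (k - n).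
Proof.
rewrite /tdrop; elim: n k => [|n IH] k; first by rewrite subn0.
case: k => [|k]; last by rewrite subSS -IH.
by rewrite -[RHS](IH 0).
Qed.

Lemma teqn_nat a b : teqn (enc_nat a) (enc_nat b) = enc_bool (a == b).
Proof.
rewrite /teqn !tdrop_nat eqn_leq -!subn_eq0.
by case: (b - a)%N => [|k] /=; rewrite ?andbF // andbT; case: (a - b)%N.
Qed.

Lemma tand_bool a b : tand (enc_bool a) (enc_bool b) = enc_bool (a && b).
Proof. by case: a. Qed.
Lemma tor_bool a b : tor (enc_bool a) (enc_bool b) = enc_bool (a || b).
Proof. by case: a. Qed.

Section Correct.
Variables (E : finType) (B : biordered E).
Local Notation T := (enc_biordered B).
Local Notation encE := (@enc_elt E).

Lemma enc_elt_eq e f : teqn (encE e) (encE f) = enc_bool (e == f).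
Proof.
by rewrite teqn_nat -(inj_eq enum_rank_inj) -val_eqE.
Qed.

Lemma nth_rank e e0 : nth e0 (enum E) (enum_rank e) = e.
Proof. by rewrite -(enum_val_nth e0) enum_rankK. Qed.

Lemma tbop_bop e f : tbop T (encE e) (encE f) = enc_option encE (bop B e f).
Proof.
rewrite /tbop /enc_biordered tdrop_seq (hd_drop _ e) -?cardE // nth_rank.
by rewrite tdrop_seq (hd_drop _ f) -?cardE // nth_rank.
Qed.

Lemma tbopis_bop e f g : tbopis T (encE e) (encE f) (encE g) = enc_bool (bop B e f == Some g).
Proof.
by rewrite /tbopis tbop_bop; case: (bop B e f) => [h|] //=; rewrite enc_elt_eq.
Qed.

Lemma tlen_seq U (enc : U -> tree) s : tlen (enc_seq enc s) = enc_nat (size s).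
Proof. by rewrite /tlen (foldt_iter _ (Cons Nil)). Qed.

Lemma telems_enum : telems T = enc_seq encE (enum E).
Proof.
have -> : enc_seq encE (enum E) = enc_seq enc_nat (seq.iota 0 #|E|).
  have -> : seq.iota 0 #|E| = [seq nat_of_ord (enum_rank e) | e <- enum E].
    apply: (@eq_from_nth _ 0) => [|i]; rewrite size_iota.
      by rewrite (size_map _ (enum E)) -cardE.
    move=> hi.
    rewrite nth_iota // (nth_map (enum_val (Ordinal hi))) ?add0n -?cardE //.
    by rewrite -[i in nth _ _ i]/(nat_of_ord (Ordinal hi)) -enum_val_nth enum_valK.
  by rewrite enc_seq_map.
rewrite /telems /enc_biordered (foldt_iter _ (fun acc => tapp acc (Cons (tlen acc) Nil))) -cardE.
elim: #|E| => [//|n IH]; rewrite iterS IH tlen_seq size_iota.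
rewrite -[Cons _ Nil]/(enc_seq enc_nat [:: n]) tapp_seq -addn1 iotaD //.
Qed.

Lemma tmedge_medge p1 p2 q1 q2 :
  tmedge T (encE p1) (encE p2) (encE q1) (encE q2) = enc_bool (medge B (p1, p2) (q1, q2)).
Proof.
rewrite /tmedge telems_enum foldt_seq /medge.
set c := fun e => [&& bop B e q1 == Some q1, bop B q1 e == Some p1,
  bop B p2 e == Some p2 & bop B e p2 == Some q2].
have -> : [exists e, c e] = has c (enum E).
  apply/existsP/hasP => -[e h]; first by exists e; rewrite ?mem_enum.
  by move=> ce; exists e.
rewrite -[has _ _]orbF -[Nil]/(enc_bool false).
elim: (enum E) false => [|e s IH] b /=; first by [].
by rewrite !tbopis_bop !tand_bool tor_bool IH -/(c e); congr enc_bool;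
  case: (c e); case: (has c s); case: b.
Qed.

Lemma tedge_edge p1 p2 q1 q2 :
  tedge T (encE p1) (encE p2) (encE q1) (encE q2) = enc_bool (edge B (p1, p2) (q1, q2)).
Proof. by rewrite /tedge !tmedge_medge tor_bool. Qed.

Lemma tsame_same c1 c2 p1 p2 :
  tsame T (encE c1) (encE c2) (encE p1) (encE p2) =
  enc_bool (same_state B (c1, c2) (p1, p2)).
Proof. by rewrite /tsame !tbopis_bop !tand_bool. Qed.

Definition enc_entry (w : (E * E) * seq ((E * E) * (E * E))) : tree :=
  Cons (Cons (encE w.1.1) (encE w.1.2)) (enc_ratexp (word_exp w.2)).

Lemma textend_extend W :
  textend T (enc_seq enc_entry W) = enc_seq enc_entry (extend B W).
Proof.
rewrite /textend /extend -tapp_seq telems_enum; congr tapp.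
apply: tmapcat_seq => -[[c1 c2] w].
do 4!(apply: tmapcat_seq => ?).
rewrite /= tsame_same tedge_edge tand_bool; case: ifP => //= _.
by rewrite /enc_entry /= /word_exp foldl_rcons.
Qed.

Lemma twalks_walks c1 c2 : twalks T (encE c1) (encE c2) =
  enc_seq enc_entry (walks B (nsteps E) (c1, c2)).
Proof.
rewrite /twalks -[Cons (Cons _ _) Nil]/(enc_seq enc_entry [:: ((c1, c2), [::])]).
have h (s : seq E) acc : foldt (fun _ a => textend T (textend T a))
    (enc_seq (fun e => enc_seq (fun f => enc_option encE (bop B e f)) (enum E)) s)
    (enc_seq enc_entry acc) = enc_seq enc_entry (iter (size s * 2) (extend B) acc).
  rewrite (foldt_iter _ (fun a => textend T (textend T a))) iterM.
  by elim: (size s) => //= n ->; rewrite !textend_extend.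
have hT : T = enc_seq (fun e => enc_seq (fun f => enc_option encE (bop B e f))
  (enum E)) (enum E) by [].
have hF acc : foldt (fun _ a => textend T (textend T a)) T (enc_seq enc_entry acc) =
    enc_seq enc_entry (iter (#|E| * 2) (extend B) acc).
  by rewrite [X in foldt _ X]hT h cardE.
rewrite [X in foldt _ X]hT.
rewrite (foldt_iter _ (fun a => foldt (fun _ a' => textend T (textend T a')) T a)) -cardE.
rewrite /walks /nsteps iterM.
suff g n : iter n (fun a => foldt (fun _ a' => textend T (textend T a')) T a)
    (enc_seq enc_entry [:: ((c1, c2), [::])]) =
  enc_seq enc_entry (iter n (iter (#|E| * 2) (extend B)) [:: ((c1, c2), [::])]) by exact: g.
by elim: n => //= n ->; rewrite hF.
Qed.

Lemma tunion_union W c1 c2 : tunion T (enc_seq enc_entry W) (encE c1) (encE c2) =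
  enc_ratexp (union_exp (words_to B W (c1, c2))).
Proof.
rewrite /tunion foldt_trev /words_to.
elim: W => [//|[[d1 d2] w] W IH] /=; rewrite IH tsame_same.
by case: (same_state _ _ _).
Qed.

Theorem trho_rho el ei emu ej : trho (enc_input B [:: el; ei; emu; ej]) =
  enc_ratexp (rho_exp B el ei emu ej).
Proof. by rewrite /trho /= twalks_walks !tunion_union. Qed.

End Correct.

(** * The theorem *)

Section ClassNames.
Variables (E : finType) (B : biordered E) (D : regDclass (IG B)).
Variable C : coordinatisation (dcls D).
Local Notation emb := (@emb _ B).

(** Regularity is invariant under Green relations, so all of a regular D-class
    is regular and each of its L-classes and R-classes has a name. *)
Lemma regular_greenR (x y : IG B) : greenR x y -> regular (emb x) -> regular (emb y).
Proof.
by move=> [/leRP[a xE] /leRP[b yE]]; rewrite yE; apply: regular_rc; exists a; rewrite mulgA -yE.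
Qed.
Lemma regular_greenL (x y : IG B) : greenL x y -> regular (emb x) -> regular (emb y).
Proof.
by move=> [/leLP[a xE] /leLP[b yE]]; rewrite yE; apply: regular_lc; exists a; rewrite -mulgA -yE.
Qed.

Lemma Dclass_regular x : dcls D x -> regular (emb x).
Proof.
have [e de ee] := dcls_regular D.
have [x0 hD] := dcls_class D; rewrite hD in de *.
move=> [z [h1 h2]]; have [z' [h3 h4]] := de.
apply: regular_greenR h2 _; apply: regular_greenL h1 _.
apply: regular_greenL (greenL_sym h3) _; apply: regular_greenR (greenR_sym h4) _.
by exists (emb e); rewrite -!emb_mul !ee.
Qed.

Lemma Lclass_name (l : crd_L C) : exists e, Lcls l (ig_gen B e).
Proof.
have [e0 /(crd_onto C)[[[i g] l0] _] _] := dcls_regular D.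
have [y xyx] := Dclass_regular (crdD (i, g, l)).
have [||h hE] := @idem_gn _ B (y * emb (crd (i, g, l))).
- by move/mul_eq1 => [_ /emb_neq1].
- by rewrite -mulgA (mulgA _ y) xyx.
have hL : greenL (crd (i, g, l)) (ig_gen B h).
  apply: (@greenL_lc _ _ _ _ y); first by rewrite emb_gen hE.
  by exists (emb (crd (i, g, l))).
have [[[i' g'] l'] h'] := crd_onto C (Dclass_L (dcls_class D) hL (crdD _)).
exists h, i', g'; rewrite -h'; congr (crd (_, _, _)).
by apply/esym/((@crd_greenL _ _ C (i, g, l) (i', g', l')).1); rewrite h'.
Qed.

Lemma Rclass_name (i : crd_I C) : exists e, Rcls i (ig_gen B e).
Proof.
have [e0 /(crd_onto C)[[[i0 g] l] _] _] := dcls_regular D.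
have [y xyx] := Dclass_regular (crdD (i, g, l)).
have [||h hE] := @idem_gn _ B (emb (crd (i, g, l)) * y).
- by move/mul_eq1 => [/emb_neq1].
- by rewrite mulgA xyx.
have hR : greenR (crd (i, g, l)) (ig_gen B h).
  apply: (@greenR_rc _ _ _ _ y); first by rewrite emb_gen hE.
  by exists (emb (crd (i, g, l))); rewrite mulgA.
have [[[i' g'] l'] h'] := crd_onto C (Dclass_R (dcls_class D) hR (crdD _)).
exists h, g', l'; rewrite -h'; congr (crd (_, _, _)).
by apply/esym/((@crd_greenR _ _ C (i, g, l) (i', g', l')).1); rewrite h'.
Qed.

End ClassNames.

Theorem theorem5p2 (crds : coordinates_system)
    (hcrds : computably_presented crds) :
  exists p : prog,
  forall (E : finType) (B : biordered E) (m : nat)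
    (D : 'I_m.+1 -> regDclass (IG B)),
  let C := fun k : 'I_m.+1 => crds E B (D k) in
  exists rho : forall s : 'I_m,
      crd_L (C (before s)) -> crd_I (C (after s)) ->
      crd_L (C (before s)) -> crd_I (C (after s)) ->
      set (crd_grp (C (before s)) * dual_group (crd_grp (C (after s)))),
  [/\ (forall s l i mu j, rational (rho s l i mu j)),
      (* an index is given to the algorithm by an idempotent of its class *)
      (forall (s : 'I_m) l i mu j (el ei emu ej : E),
        Lcls l (ig_gen B el) -> Rcls i (ig_gen B ei) ->
        Lcls mu (ig_gen B emu) -> Rcls j (ig_gen B ej) ->
        exists2 r : ratexp (letter2 E),
          runs p (enc_input B [:: el; ei; emu; ej]) (enc_ratexp r) &
          denotes (@letter2_val E B _ _ (C (before s)) (C (after s))) r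
            (rho s l i mu j)) &
      (forall x y : forall k, crd_I (C k) * crd_grp (C k) * crd_L (C k),
        irreducible_rseq (fun k => crd (x k)) ->
        irreducible_rseq (fun k => crd (y k)) ->
        (ordprod (fun k => crd (x k)) ord0 ord_max
         = ordprod (fun k => crd (y k)) ord0 ord_max
         <->
         [/\ (x ord0).1.1 = (y ord0).1.1,
             (x ord_max).2 = (y ord_max).2 &
             problemP (fun s => rho s (x (before s)).2 (x (after s)).1.1
                                      (y (before s)).2 (y (after s)).1.1)
               (fun k => (x k).1.2) (fun k => (y k).1.2)]))].
Proof.
have [p hp] := comp_trho; exists p => E B m D C.
have DD k : is_Dclass (dcls (D k)) := dcls_class (D k).
have rhoP (s : 'I_m) l i mu j (el ei emu ej : E) :
    Lcls l (ig_gen B el) -> Rcls i (ig_gen B ei) ->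
    Lcls mu (ig_gen B emu) -> Rcls j (ig_gen B ej) ->
    denotes (@letter2_val E B _ _ (C (before s)) (C (after s)))
      (rho_exp B el ei emu ej) (@rho _ _ _ (fun k => dcls (D k)) C s l i mu j).
  move=> h1 h2 h3 h4.
  by apply: (denotes_rho (DD _) (DD _) (s0 := (l, i))); split.
exists (fun s => @rho _ _ _ (fun k => dcls (D k)) C s); split.
- move=> s l i mu j.
  have [el h1] := Lclass_name l; have [ei h2] := Rclass_name i.
  have [emu h3] := Lclass_name mu; have [ej h4] := Rclass_name j.
  exact: denotes_rational (rhoP _ _ _ _ _ _ _ _ _ h1 h2 h3 h4).
- move=> s l i mu j el ei emu ej h1 h2 h3 h4; exists (rho_exp B el ei emu ej).
    by rewrite -trho_rho; apply: hp.
  exact: rhoP.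
- move=> x y ix iy; split=> [h|h]; first exact: (equal_linked DD).
  exact: linked_equal h.
Qed.
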